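(* For every $k\ge0$, \[ g_k(\bullet;x,q)=\sum_{\lambda\vdash k}c_{\lambda}(q)\,m_{\lambda}, \] where $m_\lambda$ is the monomial symmetric function and $c_\lambda(q)=\sum_{\overline w}q^{\mathrm{exc}_{w_\lambda}(\overline w)}$, the sum running over all derangements $\overline w$ of the word $w_\lambda$.
   Context: Derangements. Let $w=w_1\cdots w_n$ be a word in the positive integers. A derangement of $w$ is a word $\overline w=\overline w_1\cdots\overline w_n$ in which every letter appears the same number of times as in $w$ and such that $\overline w_j\ne w_j$ for every $j$. $\mathrm{exc}_w(\overline w)$ is the number of $j\in[n]$ with $\overline w_j>w_j$. For a partition $\lambda=(\lambda_1,\dots,\lambda_\ell)$, $w_\lambda=1^{\lambda_1}2^{\lambda_2}\cdots\ell^{\lambda_\ell}$. The functions $g_k$. $[n]=\{1,\dots,n\}$. A Hessenberg function is a non-decreasing $\mathbf m\colon[n]\to[n]$ with $\mathbf m(i)\ge i$ for all $i$. $h_j,e_j$ are the complete homogeneous and elementary symmetric functions ($h_0=e_0=1$), and $\omega$ is the $q$-linear involution with $\omega(h_j)=e_j$. With $[n]_q=1+q+\dots+q^{n-1}$, $\rho_n$ ($n\ge1$) is defined recursively by $[n]_qh_n=\sum_{i=0}^{n-1}h_i\rho_{n-i}$. $S_{n,\mathbf m}=\{\sigma\in S_n:\sigma(i)\le\mathbf m(i)\text{ for all }i\}$. Each $\sigma\in S_n$ is written as its cycle decomposition $\sigma=\tau_1\cdots\tau_j$ (fixed points included), each cycle beginning with its smallest element and cycles ordered increasingly by their smallest elements;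 $|\tau_i|$ is the length of $\tau_i$. $\sigma^c$ is the permutation whose one-line notation is obtained by erasing the parentheses. $\mathrm{wt}_{\mathbf m}(\sigma)$ is the number of pairs $(i,j)$ with $i<j\le\mathbf m(i)$ and $(\sigma^c)^{-1}(i)>(\sigma^c)^{-1}(j)$. For $k<n$, \[ g_k(\mathbf m;x,q):=\sum_{\substack{\sigma=\tau_1\cdots \tau_{j}\in S_{n,\mathbf m}\\ |\tau_1|\geq n-k}} (-1)^{|\tau_1|-n+k}q^{\mathrm{wt}_{\mathbf m}(\sigma)}h_{|\tau_1|-n+k}\,\omega(\rho_{|\tau_2|}\cdots \rho_{|\tau_j|}). \] The path graph $P_n$ corresponds to $\mathbf m(i)=\min(i+1,n)$, and $g_k(P_n;x,q)$ denotes $g_k$ of this Hessenberg function. $\bullet$ is the graph with a single vertex, and for every $k\ge0$ one defines $g_k(\bullet;x,q):=g_k(P_N;x,q)$ for any $N>k$ (the value does not depend on $N$). *)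

(* Defs.v *)
From HB Require Import structures.
From mathcomp Require Import all_boot all_order all_fingroup all_algebra.
From mathcomp Require Import boolp.
From mathcomp Require Import mpoly.

Set Implicit Arguments.
Unset Strict Implicit.
Unset Printing Implicit Defensive.

Import GRing.Theory.
Local Open Scope ring_scope.

Section MProj.
Variable R : comNzRingType.

(* mproj m : R[x_0..x_(n-1)] -> R[x_0..x_(m-1)] keeps x_i for i < m and sends
   the other variables to 0. *)
Definition mproj_var n m : n.-tuple {mpoly R[m]} :=
  [tuple (if insub (val i) is Some j then 'X_(j : 'I_m) else 0) | i < n].

Definition mproj n m (p : {mpoly R[n]}) : {mpoly R[m]} := p \mPo mproj_var n m.

HB.instance Definition _ n m :=
  GRing.LRMorphism.copy (@mproj n m) (comp_mpoly (mproj_var n m)).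

Definition mnm_pad n m (a : 'X_{1..m}) : 'X_{1..n} :=
  [multinom nth 0%N a i | i < n].

Lemma mproj_X n m (b : 'X_{1..n}) (a : 'X_{1..m}) : (m <= n)%N ->
  (mproj m 'X_[R, b])@_a = (b == mnm_pad n a)%:R.
Proof.
move=> le_mn; rewrite /mproj comp_mpolyX.
pose G k : {mpoly R[m]} :=
  (if insub k is Some j then 'X_(j : 'I_m) else 0) ^+ nth 0%N b k.
under eq_bigr => i _ do rewrite tnth_mktuple (mnm_nth 0%N) -/(G (val i)).
rewrite -(big_mkord xpredT G) (big_cat_nat _ (n := m)) //= big_mkord.
pose a' := [multinom nth 0%N b i | i < m].
have -> : \prod_(i < m) G i = 'X_[a'].
  rewrite [RHS]mpolyXE_id; apply: eq_bigr => i _; rewrite /G insubT //= => ltim.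
  by rewrite mnmE; congr ('X_ _ ^+ _); apply: val_inj.
case: (boolP [exists i : 'I_n, (m <= i)%N && (0 < b i)%N]) => [/existsP[i]|].
  case/andP=> lemi bi_gt0; rewrite (_ : \prod_(m <= k < n) G k = 0).
    rewrite mulr0 mcoeff0; case: eqP => // eb; move: bi_gt0.
    by rewrite eb mnmE nth_default ?size_tuple.
  rewrite (big_cat_nat _ (n := i)) //=; last exact: ltnW.
  rewrite [X in _ * X]big_ltn // /G insubF; last by rewrite ltnNge lemi.
  by rewrite -(mnm_nth 0%N) expr0n eqn0Ngt bi_gt0 mul0r mulr0.
rewrite negb_exists => /forallP b0.
have bk0 k : (m <= k)%N -> nth 0%N b k = 0%N.
  move=> lemk; case: (ltnP k n) => [ltkn|lenk]; last first.
    by rewrite nth_default ?size_tuple.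
  have := b0 (Ordinal ltkn); rewrite /= lemk /= (mnm_nth 0%N) /= -eqn0Ngt.
  by move/eqP.
rewrite [X in _ * X]big_nat [X in _ * X]big1 => [|k /andP[lemk _]]; last first.
  by rewrite /G bk0 ?expr0.
rewrite mulr1 mcoeffX; congr (_%:R); congr nat_of_bool; apply/eqP/eqP => [<-|eb].
  apply/mnmP => i; rewrite (mnm_nth 0%N) mnmE.
  case: (ltnP i m) => [ltim|lemi]; last by rewrite bk0 ?[RHS]nth_default ?size_tuple.
  by rewrite -[nth _ a' _]/(nth _ a' (Ordinal ltim)) -(mnm_nth _ a') mnmE.
apply/mnmP => i; rewrite mnmE eb.
rewrite -[nth _ _ _]/(nth _ (mnm_pad n a) (widen_ord le_mn i)).
rewrite -(mnm_nth _ (mnm_pad n a)) mnmE /=.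
by rewrite -mnm_nth.
Qed.

Lemma mproj_coeff n m (p : {mpoly R[n]}) (a : 'X_{1..m}) : (m <= n)%N ->
  (mproj m p)@_a = p@_(mnm_pad n a).
Proof.
move=> le_mn; rewrite {1}[p]mpolyE (raddf_sum (@mproj n m)) {3}[p]mpolyE.
rewrite !linear_sum /=.
apply: eq_bigr => b _.
by rewrite [mproj _ _]comp_mpolyZ !mcoeffZ mproj_X // mcoeffX.
Qed.

End MProj.

Section MFamily.
Variable R : comNzRingType.

Definition mfamily := forall n : nat, {mpoly R[n]}.

HB.instance Definition _ := gen_eqMixin mfamily.
HB.instance Definition _ := gen_choiceMixin mfamily.

Implicit Types f g : mfamily.

Fact mfamilyP f g : (forall n, f n = g n) -> f = g.
Proof. exact: functional_extensionality_dep. Qed.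

Definition mfam0 : mfamily := fun n => 0.
Definition mfam1 : mfamily := fun n => 1.
Definition mfam_opp f : mfamily := fun n => - f n.
Definition mfam_add f g : mfamily := fun n => f n + g n.
Definition mfam_mul f g : mfamily := fun n => f n * g n.
Definition mfam_scale (c : R) f : mfamily := fun n => c *: f n.

Fact mfam_addA : associative mfam_add.
Proof. by move=> f g k; apply: mfamilyP => n; exact: addrA. Qed.
Fact mfam_addC : commutative mfam_add.
Proof. by move=> f g; apply: mfamilyP => n; exact: addrC. Qed.
Fact mfam_add0 : left_id mfam0 mfam_add.
Proof. by move=> f; apply: mfamilyP => n; exact: add0r. Qed.
Fact mfam_addN : left_inverse mfam0 mfam_opp mfam_add.
Proof. by move=> f; apply: mfamilyP => n; exact: addNr. Qed.

HB.instance Definition _ :=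
  GRing.isZmodule.Build mfamily mfam_addA mfam_addC mfam_add0 mfam_addN.

Fact mfam_mulA : associative mfam_mul.
Proof. by move=> f g k; apply: mfamilyP => n; exact: mulrA. Qed.
Fact mfam_mulC : commutative mfam_mul.
Proof. by move=> f g; apply: mfamilyP => n; exact: mulrC. Qed.
Fact mfam_mul1 : left_id mfam1 mfam_mul.
Proof. by move=> f; apply: mfamilyP => n; exact: mul1r. Qed.
Fact mfam_mulD : left_distributive mfam_mul mfam_add.
Proof. by move=> f g k; apply: mfamilyP => n; exact: mulrDl. Qed.
Fact mfam_1neq0 : mfam1 != 0 :> mfamily.
Proof. by apply/eqP => /(congr1 (fun f : mfamily => f 0%N)); exact/eqP/oner_neq0. Qed.

HB.instance Definition _ := GRing.Zmodule_isComNzRing.Build mfamily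
  mfam_mulA mfam_mulC mfam_mul1 mfam_mulD mfam_1neq0.

Fact mfam_scaleA a b f : mfam_scale a (mfam_scale b f) = mfam_scale (a * b) f.
Proof. by apply: mfamilyP => n; exact: scalerA. Qed.
Fact mfam_scale1 : left_id 1 mfam_scale.
Proof. by move=> f; apply: mfamilyP => n; exact: scale1r. Qed.
Fact mfam_scaleDr : right_distributive mfam_scale +%R.
Proof. by move=> a f g; apply: mfamilyP => n; exact: scalerDr. Qed.
Fact mfam_scaleDl f : {morph mfam_scale^~ f : a b / a + b}.
Proof. by move=> a b; apply: mfamilyP => n; exact: scalerDl. Qed.

HB.instance Definition _ := GRing.Zmodule_isLmodule.Build R mfamily
  mfam_scaleA mfam_scale1 mfam_scaleDr mfam_scaleDl.

Fact mfam_scaleAl (a : R) f g : a *: (f * g) = a *: f * g.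
Proof. by apply: mfamilyP => n; exact: scalerAl. Qed.

HB.instance Definition _ := GRing.Lmodule_isLalgebra.Build R mfamily mfam_scaleAl.

Fact mfam_scaleAr (a : R) f g : a *: (f * g) = f * (a *: g).
Proof. by apply: mfamilyP => n; exact: scalerAr. Qed.

HB.instance Definition _ := GRing.Lalgebra_isAlgebra.Build R mfamily mfam_scaleAr.

(* The ring of symmetric functions in infinitely many variables over R is the
   inverse limit, in the category of graded rings, of the rings of symmetric
   polynomials in n variables: an element is a family of symmetric polynomials
   of bounded degree which is compatible with setting variables to 0. The sub
   ring structure is the componentwise one. *)
Definition is_symfun f : Prop :=
  [/\ forall n, f n \is symmetric,
      forall n m, (m <= n)%N -> mproj m (f n) = f m
    & exists d, forall n, (msize (f n) <= d)%N].

Definition symfun_pred : {pred mfamily} := fun f => `[< is_symfun f >].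

Fact symfun_subalg_closed : subalg_closed symfun_pred.
Proof.
split=> [|c f g /asboolP[fS fC [df fB]] /asboolP[gS gC [dg gB]]|f g /asboolP[fS fC [df fB]] /asboolP[gS gC [dg gB]]].
- apply/asboolP; split=> [n|n m _|].
  + exact: rpred1.
  + exact: (rmorph1 (@mproj R n m)).
  + by exists 1%N => n; rewrite msize1.
- apply/asboolP; split=> [n|n m le_mn|].
  + exact: rpredD (rpredZ _ (fS n)) (gS n).
  + by rewrite [LHS]comp_mpolyD comp_mpolyZ; congr (_ *: _ + _); [exact: fC|exact: gC].
  + exists (maxn df dg) => n; apply: leq_trans (msizeD_le _ _) _.
    rewrite geq_max !leq_max (leq_trans (msizeZ_le _ _) (fB n)) /=.
    by rewrite gB orbT.
- apply/asboolP; split=> [n|n m le_mn|].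
  + exact: rpredM (fS n) (gS n).
  + by rewrite [LHS]rmorphM; congr (_ * _); [exact: fC|exact: gC].
  + exists (df + dg).+1 => n; apply: leq_trans (msizeM_le _ _) _.
    by rewrite ltnS leq_add.
Qed.

HB.instance Definition _ :=
  GRing.isSubalgClosed.Build R mfamily symfun_pred symfun_subalg_closed.

Record symfun := SymFun { symfun_val : mfamily; _ : symfun_val \in symfun_pred }.

HB.instance Definition _ := [isSub for symfun_val].
HB.instance Definition _ := [Choice of symfun by <:].
HB.instance Definition _ := [SubChoice_isSubComNzRing of symfun by <:].
HB.instance Definition _ := [SubZmodule_isSubLmodule of symfun by <:].
HB.instance Definition _ := [SubNzRing_SubLmodule_isSubLalgebra of symfun by <:].
HB.instance Definition _ := [SubLalgebra_isSubAlgebra of symfun by <:].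
End MFamily.

Section SymFun.
Variable R : comNzRingType.
Local Notation Sym := (symfun R).

Definition sf_at n (f : Sym) : {mpoly R[n]} := symfun_val f n.
Arguments sf_at : simpl never.

Lemma symfunP (f g : Sym) : (forall n, sf_at n f = sf_at n g) <-> f = g.
Proof. by split=> [eq_fg|-> //]; apply/val_inj/mfamilyP. Qed.

Fact sf_at_is_linear n : linear (sf_at n).
Proof. by move=> c f g. Qed.
HB.instance Definition _ n := GRing.isLinear.Build R Sym {mpoly R[n]} _ (sf_at n)
  (sf_at_is_linear n).

Fact sf_at_is_monoid_morphism n : monoid_morphism (sf_at n).
Proof. by split. Qed.
HB.instance Definition _ n := GRing.isMonoidMorphism.Build Sym {mpoly R[n]} (sf_at n)
  (sf_at_is_monoid_morphism n).

Lemma sf_at_sym n f : sf_at n f \is symmetric.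
Proof. by case: f => f fP; have /asboolP[fS _ _] := fP; exact: fS. Qed.

Lemma sf_at_proj n m f : (m <= n)%N -> mproj m (sf_at n f) = sf_at m f.
Proof. by case: f => f fP; have /asboolP[_ fC _] := fP; exact: fC. Qed.

Lemma sf_at_bound f : exists d, forall n, (msize (sf_at n f) <= d)%N.
Proof. by case: f => f fP; have /asboolP[_ _ fB] := fP; exact: fB. Qed.

(* The nonzero exponents of a monomial, in non-increasing order. *)
Definition mshape n (a : 'X_{1..n}) : seq nat :=
  sort geq [seq i <- (a : seq nat) | (0 < i)%N].

Lemma mshape_sym n (a : 'X_{1..n}) (s : 'S_n) :
  mshape [multinom a (s i) | i < n] = mshape a.
Proof.
apply/perm_sortP.
- by move=> x y; exact: leq_total.
- by move=> x y z /= lexy lezx; exact: leq_trans lezx lexy.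
- by move=> x y; rewrite /= andbC -eqn_leq => /eqP.
by apply: perm_filter; apply/tuple_permP; exists s.
Qed.

Lemma mnm_pad_seq n m (a : 'X_{1..m}) : (m <= n)%N ->
  mnm_pad n a = a ++ nseq (n - m) 0%N :> seq nat.
Proof.
move=> le_mn; apply: (@eq_from_nth _ 0%N) => [|i].
  by rewrite size_cat size_nseq !size_tuple subnKC.
rewrite size_tuple => ltin.
rewrite -[i]/(val (Ordinal ltin)) -(mnm_nth _ (mnm_pad n a)) mnmE /= nth_cat size_tuple.
case: ltnP => // lemi; rewrite nth_nseq nth_default ?size_tuple //.
by case: ifP.
Qed.

Lemma mshape_pad n m (a : 'X_{1..m}) : (m <= n)%N ->
  mshape (mnm_pad n a) = mshape a.
Proof.
move=> le_mn; rewrite /mshape mnm_pad_seq // filter_cat.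
rewrite [X in _ ++ X](_ : _ = [::]) ?cats0 //; apply/eqP.
by rewrite -size_eq0 size_filter count_nseq.
Qed.

Lemma sumn_mshape n (a : 'X_{1..n}) : sumn (mshape a) = mdeg a.
Proof.
rewrite (perm_sumn (permEl (perm_sort _ _))) /mdeg.
elim: (a : seq nat) => [|x s IHs] /=; first by rewrite big_nil.
by rewrite big_cons -IHs; case: x.
Qed.

Lemma symfun_of_shape (f : mfamily R) (phi : seq nat -> R) d :
    (forall n a, (f n)@_a = phi (mshape a)) ->
    (forall n, (msize (f n) <= d)%N) ->
  f \in @symfun_pred R.
Proof.
move=> fE fB; apply/asboolP; split; last by exists d.
  by move=> n; apply/issymP => s; apply/mpolyP => a; rewrite mcoeff_sym !fE mshape_sym.
by move=> n m le_mn; apply/mpolyP => a; rewrite mproj_coeff // !fE mshape_pad.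
Qed.

Lemma mcoeff_sumX n d (P : pred 'X_{1..n}) (b : 'X_{1..n}) :
  (\sum_(a : 'X_{1..n < d} | P a) 'X_[R, a])@_b = (P b && (mdeg b < d)%N)%:R.
Proof.
rewrite raddf_sum /=; under eq_bigr => a _ do rewrite mcoeffX.
case: (ltnP (mdeg b) d) => [ltbd|ledb]; last first.
  rewrite andbF big1 // => a _; case: eqP => // eqab.
  by move: ledb; rewrite -eqab leqNgt bmdeg.
rewrite andbT big_mkcond (bigD1 (BMultinom ltbd)) //= eqxx.
rewrite big1 ?addr0 => [|a]; first by case: (P b).
rewrite -val_eqE /= => /negbTE->.
by case: (P a).
Qed.

Lemma msize_sumX n d (P : pred 'X_{1..n}) :
  (msize (\sum_(a : 'X_{1..n < d} | P a) 'X_[R, a]) <= d)%N.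
Proof.
apply: leq_trans (mmeasure_sum _ _ _ _) _; apply/bigmax_leqP => a _.
by rewrite mmeasureX bmdeg.
Qed.

Definition hfamily j : mfamily R := fun n =>
  \sum_(a : 'X_{1..n < j.+1} | mdeg a == j) 'X_[a].

Fact hfamily_coeff j n a : (hfamily j n)@_a = (mdeg a == j)%:R.
Proof. by rewrite (mcoeff_sumX _ (fun a => mdeg a == j)); case: eqP => //= ->; rewrite ltnSn. Qed.

Fact hfamily_symfun j : hfamily j \in @symfun_pred R.
Proof.
apply: (@symfun_of_shape _ (fun s => (sumn s == j)%:R) j.+1) => [n a|n].
  by rewrite hfamily_coeff sumn_mshape.
exact: (msize_sumX _ (fun a => mdeg a == j)).
Qed.

Definition sym_h j : Sym := SymFun (hfamily_symfun j).

Definition efamily j : mfamily R := fun n => mesym n R j.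

Fact efamily_symfun j : efamily j \in @symfun_pred R.
Proof.
apply: (@symfun_of_shape _
  (fun s => ((sumn s == j) && all (fun x => x <= 1)%N s)%:R) j.+1) => [n a|n].
  rewrite mcoeff_mesym sumn_mshape all_sort all_filter; congr (_ && _)%:R.
  apply/forallP/allP => [a1 x /(nthP 0%N)[i]|a1 i].
    rewrite size_tuple => ltin <-; apply/implyP => _.
    by have := a1 (Ordinal ltin); rewrite (mnm_nth 0%N).
  have := a1 (a i); rewrite (mnm_nth 0%N) mem_nth ?size_tuple // => /(_ isT) /=.
  by case: (nth _ _ _).
rewrite /efamily mesymE; apply: leq_trans (mmeasure_sum _ _ _ _) _.
by apply/bigmax_leqP => S /eqP <-; rewrite mmeasureX /= mdeg_mesym1.
Qed.

Definition sym_e j : Sym := SymFun (efamily_symfun j).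

(* m_la is the sum of the distinct monomials whose nonzero exponents are, up to
   order, the parts of la. *)
Definition mon_family (la : seq nat) : mfamily R := fun n =>
  \sum_(a : 'X_{1..n < (sumn la).+1}
        | perm_eq [seq i <- ((a : 'X_{1..n}) : seq nat) | (0 < i)%N] la) 'X_[a].

Fact mon_family_symfun la : mon_family la \in @symfun_pred R.
Proof.
apply: (@symfun_of_shape _ (fun s => (perm_eq s la)%:R) (sumn la).+1) => [n a|n].
  rewrite (mcoeff_sumX _ (fun a : 'X_{1..n} => perm_eq [seq i <- a : seq nat | (0 < i)%N] la)).
  rewrite perm_sort; case: (boolP (perm_eq _ la)) => //= pla; rewrite -sumn_mshape.
  by rewrite (@perm_sumn _ la) ?ltnSn // perm_sort.
exact: (msize_sumX _ (fun a : 'X_{1..n} => perm_eq [seq i <- a : seq nat | (0 < i)%N] la)).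
Qed.

Definition sym_m la : Sym := SymFun (mon_family_symfun la).

End SymFun.

Section EH.
Variable R : comNzRingType.

Fact mcoeffMX_le n (p : {mpoly R[n]}) (m a : 'X_{1..n}) :
  (p * 'X_[m])@_a = if (m <= a)%MM then p@_(a - m)%MM else 0.
Proof.
case: ifPn => [lema|nlema]; first by rewrite -{1}(submK lema) addmC mcoeffMX.
apply/eqP; rewrite mcoeff_eq0 (perm_mem (msuppMX _ _)).
apply: contra nlema => /mapP[b _ ->].
by apply/mnm_lepP => i; rewrite mnmDE leq_addr.
Qed.

Fact sum_subset_sign n (a : 'X_{1..n}) : (0 < mdeg a)%N ->
  \sum_(S : {set 'I_n}) (-1) ^+ #|S| * (mesym1 S <= a)%MM%:R = 0 :> R.
Proof.
move=> a_gt0.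
have [i0 ai0] : exists i, (0 < a i)%N.
  apply/existsP; apply: contraLR a_gt0; rewrite negb_exists => /forallP a0.
  by rewrite -leqNgt mdegE leqn0 big1 // => i _; apply/eqP; rewrite -leqn0 leqNgt a0.
have := @bigA_distr R 0 1 *%R +%R _ (fun i : 'I_n => - (0 < a i)%N%:R : R) (fun=> 1).
rewrite (bigD1 i0) //= ai0 addNr mul0r => eq0; rewrite [RHS]eq0; apply: eq_bigr => S _.
rewrite -big_mkcond /= prodrN; congr (_ * _).
case: mnm_lepP => [leSa|nle].
  rewrite big1 // => i iS; have := leSa i; rewrite mnmE iS => ->.
  by [].
case: (boolP [forall i in S, 0 < a i]%N) => [/forall_inP aS|].
  by case: nle => i; rewrite mnmE; case: (boolP (i \in S)) => // /aS.
rewrite negb_forall_in => /exists_inP[i iS /negbTE ai].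
by rewrite (bigD1 i) //= ai mul0r.
Qed.

Fact mesym_h n k : (0 < k)%N ->
  \sum_(i < k.+1) (-1) ^+ i *: (mesym n R i * hfamily R (k - i) n) = 0.
Proof.
move=> k_gt0; apply/mpolyP => a; rewrite mcoeff0 raddf_sum /=.
have coefE (i : 'I_k.+1) :
    ((-1) ^+ i *: (mesym n R i * hfamily R (k - i) n))@_a
    = \sum_(S : {set 'I_n} | #|S| == i)
        (-1) ^+ #|S| * ((mdeg a == k)%:R * (mesym1 S <= a)%MM%:R).
  rewrite mcoeffZ mesymE mulr_suml raddf_sum /= mulr_sumr.
  apply: eq_bigr => S /eqP cS; rewrite cS mulrC mulrC [X in X@_a]mulrC mcoeffMX_le.
  case: ifPn => [leSa|_]; last by rewrite !mulr0.
  rewrite hfamily_coeff mulr1; congr (_ * _%:R); congr nat_of_bool.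
  have da : mdeg a = (mdeg (a - mesym1 S)%MM + i)%N.
    by rewrite -{1}(submK leSa) mdegD mdeg_mesym1 cS.
  by rewrite da -(eqn_add2r i) subnK // -ltnS.
under eq_bigr => i _ do rewrite coefE.
case: (eqVneq (mdeg a) k) => [da|_]; last first.
  by rewrite big1 // => i _; rewrite big1 // => S _; rewrite mul0r mulr0.
rewrite [RHS](_ : 0 = \sum_(S : {set 'I_n} | (#|S| < k.+1)%N)
     (-1) ^+ #|S| * (1%:R * (mesym1 S <= a)%MM%:R)); last first.
  rewrite -[LHS](@sum_subset_sign n a) ?da // [RHS]big_mkcond /=.
  apply: eq_bigr => S _; rewrite mul1r; case: ltnP => // ltkS.
  case: (boolP (_ <= _)%MM) => [leSa|_]; last by rewrite mulr0.
  have : (#|S| <= mdeg a)%N by rewrite -(submK leSa) mdegD mdeg_mesym1 leq_addl.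
  by rewrite da leqNgt ltkS.
rewrite (partition_big (fun S : {set 'I_n} => inord #|S| : 'I_k.+1) xpredT) //=.
apply: eq_bigr => i _; apply: eq_bigl => S; apply/eqP/andP => [->|[ltSk /eqP <-]].
  by rewrite ltn_ord inord_val.
by rewrite inordK.
Qed.

Local Notation h := (sym_h R).
Local Notation e := (sym_e R).

Lemma sym_e0 : e 0 = 1.
Proof. by apply/symfunP => n; exact: mesym0E. Qed.

Lemma sym_h0 : h 0 = 1.
Proof.
apply/symfunP => n; apply/mpolyP => a; rewrite [LHS]hfamily_coeff mcoeff1.
by rewrite mdeg_eq0.
Qed.

Lemma sym_eh k : (0 < k)%N -> \sum_(i < k.+1) (-1) ^+ i *: (e i * h (k - i)) = 0.
Proof.
move=> k_gt0; apply/symfunP => n; rewrite raddf0 raddf_sum /=.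
rewrite -[RHS](@mesym_h n k k_gt0); apply: eq_bigr => i _.
by [].
Qed.

Lemma sym_he k : (0 < k)%N -> \sum_(i < k.+1) (-1) ^+ i *: (h i * e (k - i)) = 0.
Proof.
move=> k_gt0; rewrite -[RHS](scaler0 _ ((-1) ^+ k)) -[in RHS](sym_eh k_gt0) scaler_sumr.
rewrite (reindex_inj rev_ord_inj) /=; apply: eq_bigr => i _; rewrite subSS.
have leik : (i <= k)%N by rewrite -ltnS.
rewrite subKn // mulrC scalerA; congr (_ *: _).
have -> : (-1) ^+ k = (-1) ^+ (k - i) * (-1) ^+ i :> R by rewrite -exprD subnK.
by rewrite -mulrA -expr2 sqrr_sign mulr1.
Qed.

End EH.

Section Omega.
Variable R : comNzRingType.
Local Notation Sym := (symfun R).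
Local Notation h := (sym_h R).
Local Notation e := (sym_e R).

Definition sym_subst (u : nat -> Sym) n (t : {mpoly R[n]}) : Sym :=
  mmap (in_alg Sym) (fun i : 'I_n => u i.+1) t.

HB.instance Definition _ u n := GRing.RMorphism.copy (@sym_subst u n)
  (mmap (in_alg Sym) (fun i : 'I_n => u i.+1)).

Fact sym_substZ u n c (t : {mpoly R[n]}) : sym_subst u (c *: t) = c *: sym_subst u t.
Proof. by rewrite [LHS]mmapZ /= mulr_algl. Qed.

Fact sym_substXU u n (i : 'I_n) : sym_subst u 'X_i = u i.+1.
Proof. by rewrite [LHS]mmapX mmap1U. Qed.

Fact sym_subst_widen u n m (le_nm : (n <= m)%N) (t : {mpoly R[n]}) :
  sym_subst u (t \mPo [tuple 'X_(widen_ord le_nm i) | i < n]) = sym_subst u t.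
Proof.
rewrite {2}[t]mpolyE [in LHS](mpolyE t) (raddf_sum (comp_mpoly _)) !(raddf_sum (@sym_subst u _)).
apply: eq_bigr => a _; rewrite /= comp_mpolyZ !sym_substZ; congr (_ *: _).
rewrite comp_mpolyX rmorph_prod /= [RHS]mmapX; apply: eq_bigr => i _.
by rewrite tnth_mktuple rmorphXn /= sym_substXU.
Qed.

Fact sf_at_subst_e N n (t : {mpoly R[n]}) :
  sf_at N (sym_subst e t) = t \mPo [tuple mesym N R i.+1 | i < n].
Proof.
rewrite {1}[t]mpolyE (raddf_sum (@sym_subst e n)) (raddf_sum (@sf_at R N)) comp_mpolyEX.
apply: eq_bigr => a _ /=; rewrite sym_substZ.
rewrite (linearZ_LR (@sf_at R N)) /=; congr (_ *: _).
rewrite comp_mpolyX [sym_subst _ _]mmapX rmorph_prod; apply: eq_bigr => i _.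
by rewrite tnth_mktuple rmorphXn.
Qed.

Fact sym_subst_e_inj n : injective (@sym_subst e n).
Proof.
by move=> t t' /(congr1 (@sf_at R n)); rewrite !sf_at_subst_e => /msym_fundamental_un.
Qed.

Fact symmetric_shape_supp N n (a : 'X_{1..n}) : (mdeg a <= N)%N -> (N <= n)%N ->
  exists s : 'S_n, exists b : 'X_{1..N}, [multinom a (s i) | i < n] = mnm_pad n b.
Proof.
move=> daN leNn; pose pos := [seq i <- (a : seq nat) | (0 < i)%N].
pose zer := [seq i <- (a : seq nat) | ~~ (0 < i)%N].
have ppz : perm_eq (pos ++ zer) a by exact/permPl/perm_filterC.
have sz : (size pos <= N)%N.
  apply: leq_trans daN; rewrite -sumn_mshape.
  rewrite (perm_sumn (permEl (perm_sort _ _))) -/pos.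
  have : all (fun i => 0 < i)%N pos by exact: filter_all.
  elim: pos {ppz} => //= x s IHs /andP[x0 /IHs les].
  by rewrite -add1n leq_add.
have zer0 i : nth 0%N zer i = 0%N.
  case: (ltnP i (size zer)) => [lti|]; last exact: nth_default.
  have := mem_nth 0%N lti; rewrite mem_filter => /andP[+ _].
  by rewrite -eqn0Ngt => /eqP.
have [s sE] : exists s : 'S_n, pos ++ zer = [tuple tnth (a : n.-tuple nat) (s i) | i < n] :> seq nat.
  by apply/tuple_permP.
exists s; exists [multinom nth 0%N (pos ++ zer) i | i < N].
apply/mnmP => i; rewrite !mnmE.
have -> : a (s i) = nth 0%N (pos ++ zer) i.
  rewrite sE.
  by rewrite -[RHS]/(nth 0%N (val [tuple tnth (a : n.-tuple nat) (s i) | i < n]) (val i)) -tnth_nth tnth_mktuple.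
case: (ltnP i N) => [ltiN|leNi]; last first.
  rewrite [RHS]nth_default ?size_tuple // nth_cat ifF; first exact: zer0.
  by apply/negbTE; rewrite -leqNgt (leq_trans sz).
rewrite -[nth _ _ i in RHS]/(nth _ _ (val (Ordinal ltiN))).
by rewrite -(mnm_nth _ [multinom nth 0%N (pos ++ zer) i | i < N]) mnmE.
Qed.

Fact sym_e_generate (f : Sym) : exists d, forall N, (d <= N)%N ->
  exists t : {mpoly R[N]}, f = sym_subst e t.
Proof.
have [d fd] := sf_at_bound f; exists d => N ledN.
have [t [tE tw]] := sym_fundamental (sf_at_sym N f); exists t.
have {}tw : (mweight t <= d)%N by exact: leq_trans tw (fd N).
apply/eqP; rewrite -subr_eq0; apply/eqP/symfunP => n; rewrite [RHS]raddf0.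
set D := f - _; have DN : sf_at N D = 0 by rewrite raddfB /= sf_at_subst_e tE subrr.
case: (leqP n N) => [leqnN|/ltnW leqNn].
  by rewrite -(sf_at_proj D leqnN) DN [LHS]comp_mpoly0.
apply/mpolyP => a; rewrite mcoeff0.
case: (leqP d (mdeg a)) => [leda|ltad].
  rewrite [sf_at n D]raddfB /= mcoeffB (_ : (sf_at n f)@_a = 0); last first.
    apply/eqP; rewrite mcoeff_eq0; apply: msize_mdeg_ge; exact: leq_trans (fd n) leda.
  rewrite sub0r sf_at_subst_e comp_mpolyEX raddf_sum /= big_seq big1 ?oppr0 // => m mt.
  rewrite mcoeffZ [X in _ * X](_ : _ = 0) ?mulr0 //.
  have hom : 'X_[m] \mPo [tuple mesym n R i.+1 | i < N] \is (mnmwgt m).-homog.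
    rewrite comp_mpolyX.
    have -> : \prod_(i < N) tnth [tuple mesym n R i.+1 | i < N] i ^+ m i
            = \prod_(p <- [tuple mesym n R i.+1 ^+ m i | i < N]) p.
      by rewrite big_tuple; apply: eq_bigr => i _; rewrite !tnth_mktuple.
    have -> : mnmwgt m = (\sum_(i <- [tuple i.+1 * m i | i < N]) i)%N.
      by rewrite big_tuple; apply: eq_bigr => i _; rewrite !tnth_mktuple mulnC.
    by apply: dhomog_prod => i; rewrite !tnth_mktuple; exact/dhomogMn/dhomog_mesym.
  apply: (dhomog_nemf_coeff hom); rewrite neq_ltn; apply/orP; right.
  apply: leq_trans (leq_trans tw leda).
  rewrite /mmeasure (bigD1_seq m) ?msupp_uniq //= leq_max; apply/orP; left.
  exact: leqnn.
have [s [b sb]] := symmetric_shape_supp (leq_trans (ltnW ltad) ledN) leqNn.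
rewrite -(msym_coeff a s (sf_at_sym n D)) sb -mproj_coeff // sf_at_proj // DN.
by rewrite mcoeff0.
Qed.

Fact sym_subst_wd (u : nat -> Sym) n m (t : {mpoly R[n]}) (t' : {mpoly R[m]}) :
  sym_subst e t = sym_subst e t' -> sym_subst u t = sym_subst u t'.
Proof.
have len := leq_maxl n m; have lem := leq_maxr n m.
rewrite -(sym_subst_widen e len t) -(sym_subst_widen e lem t') => /sym_subst_e_inj tt'.
by rewrite -(sym_subst_widen u len t) -(sym_subst_widen u lem t') tt'.
Qed.

Fact ex_omega_fun (f : Sym) : exists g : Sym,
  forall n (t : {mpoly R[n]}), f = sym_subst e t -> g = sym_subst h t.
Proof.
have [d /(_ d (leqnn d))[t ->]] := sym_e_generate f.
by exists (sym_subst h t) => n t'; exact: sym_subst_wd.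
Qed.

Fact sym_morph_swap (a b : nat -> Sym) : a 0 = 1 -> b 0 = 1 ->
    (forall k, (0 < k)%N -> \sum_(i < k.+1) (-1) ^+ i *: (a i * b (k - i)%N) = 0) ->
    (forall k, (0 < k)%N -> \sum_(i < k.+1) (-1) ^+ i *: (b i * a (k - i)%N) = 0) ->
  forall w : {lrmorphism Sym -> Sym},
  (forall j, w (a j) = b j) -> forall j, w (b j) = a j.
Proof.
move=> a0 b0 ab ba w wa; elim/ltn_ind => -[_|k IHk]; first by rewrite a0 b0 rmorph1.
have /(congr1 w) := ab k.+1 isT; rewrite raddf0 raddf_sum => wab.
have := etrans wab (esym (ba k.+1 isT)).
rewrite big_ord_recl [RHS]big_ord_recl /= !expr0 !scale1r subn0 a0 b0 !mul1r.
rewrite [X in _ + X = _](_ : _ =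
    \sum_(i < k.+1) (-1) ^+ bump 0 i *: (b (bump 0 i) * a (k.+1 - bump 0 i)%N)).
  by move/addIr.
apply: eq_bigr => i _; rewrite linearZ /= rmorphM /= wa IHk //.
by rewrite /bump /= add1n subSS ltnS leq_subr.
Qed.

Fact exists_omega :
  exists w : {lrmorphism Sym -> Sym}, forall j, w (h j) = e j.
Proof.
pose w0 f := projT1 (cid (ex_omega_fun f)).
have w0E n (t : {mpoly R[n]}) : w0 (sym_subst e t) = sym_subst h t.
  exact: (projT2 (cid (ex_omega_fun (sym_subst e t))) n t).
have ex2 f g : exists n, exists t : {mpoly R[n]}, exists t' : {mpoly R[n]},
    f = sym_subst e t /\ g = sym_subst e t'.
  have [df /(_ _ (leq_maxl df _)) Hf] := sym_e_generate f.
  have [dg /(_ _ (leq_maxr df _)) Hg] := sym_e_generate g.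
  by exists (maxn df dg); have [t ->] := Hf dg; have [t' ->] := Hg; exists t, t'.
have w0_lin : linear w0.
  move=> c f g; have [n [t [t' [-> ->]]]] := ex2 f g.
  by rewrite -sym_substZ -raddfD !w0E raddfD /= sym_substZ.
have w0_mul : monoid_morphism w0.
  split; first by rewrite -[X in w0 X](rmorph1 (@sym_subst e 0)) w0E rmorph1.
  move=> f g; have [n [t [t' [-> ->]]]] := ex2 f g.
  by rewrite -rmorphM !w0E rmorphM.
pose wL := GRing.isLinear.Build R Sym Sym *:%R w0 w0_lin.
pose wM := GRing.isMonoidMorphism.Build Sym Sym w0 w0_mul.
pose w : {lrmorphism Sym -> Sym} := HB.pack w0 wL wM.
exists w.
have we j : w (e j) = h j.
  case: j => [|j]; first by rewrite sym_e0 sym_h0 rmorph1.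
  by rewrite -(sym_substXU e (@ord_max j)) [LHS]w0E sym_substXU.
exact: (@sym_morph_swap e h (sym_e0 R) (sym_h0 R) (@sym_eh R) (@sym_he R) w we).
Qed.

(* The endomorphism determined by h_j |-> e_j: it is unique (omega_unique) and an
   involution (omegaK). *)
Definition omega : {lrmorphism Sym -> Sym} := projT1 (cid exists_omega).

Lemma omega_h j : omega (h j) = e j.
Proof. exact: (projT2 (cid exists_omega)). Qed.

Lemma omega_e j : omega (e j) = h j.
Proof.
exact: (@sym_morph_swap h e (sym_h0 R) (sym_e0 R) (@sym_he R) (@sym_eh R) omega omega_h).
Qed.

Lemma sym_subst_morph (w : {lrmorphism Sym -> Sym}) u v n (t : {mpoly R[n]}) :
  (forall j, w (u j) = v j) -> w (sym_subst u t) = sym_subst v t.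
Proof.
move=> wuv; rewrite {1}[t]mpolyE [in RHS](mpolyE t) !(raddf_sum (@sym_subst _ n)) raddf_sum.
apply: eq_bigr => a _; rewrite /= !sym_substZ linearZ /=; congr (_ *: _).
rewrite ![sym_subst _ _]mmapX rmorph_prod /=; apply: eq_bigr => i _.
by rewrite rmorphXn /= wuv.
Qed.

Lemma omegaK : involutive omega.
Proof.
move=> f; have [d /(_ d (leqnn d))[t ->]] := sym_e_generate f.
by rewrite (sym_subst_morph t omega_e) (sym_subst_morph t omega_h).
Qed.

Lemma omega_unique (w : {lrmorphism Sym -> Sym}) :
  (forall j, w (h j) = e j) -> w =1 omega.
Proof.
move=> wh f; have [d /(_ d (leqnn d))[t ->]] := sym_e_generate f.
have we := @sym_morph_swap h e (sym_h0 R) (sym_e0 R) (@sym_he R) (@sym_eh R) w wh.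
by rewrite (sym_subst_morph t omega_e) (sym_subst_morph t we).
Qed.

End Omega.

Local Notation Zq := {poly int}.
Local Notation Lambda := (symfun Zq).
(* The parameter q is the indeterminate of {poly int} = Z[q]. *)
Local Notation q := ('X : Zq).

Definition qint n : Zq := \sum_(i < n) q ^+ i.

(* rho_seq n = [:: rho 1; ...; rho n]; the recursion of the rho_n, as usually
   written, is lemma rhoE. *)
Fixpoint rho_seq n : seq Lambda :=
  if n is n'.+1 then
    rcons (rho_seq n')
      (qint n *: sym_h Zq n - \sum_(1 <= i < n) sym_h Zq i * (rho_seq n')`_(n - i).-1)
  else [::].

Definition rho n : Lambda := (rho_seq n)`_n.-1.

Fact size_rho_seq n : size (rho_seq n) = n.
Proof. by elim: n => //= n IHn; rewrite size_rcons IHn. Qed.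

Fact nth_rho_seq n i : (0 < i <= n)%N -> (rho_seq n)`_i.-1 = rho i.
Proof.
case/andP=> i_gt0; elim: n => [|n IHn]; first by rewrite leqNgt i_gt0.
rewrite leq_eqVlt => /predU1P[-> //|lein].
rewrite /= nth_rcons size_rho_seq ifT; first exact: IHn.
by rewrite -ltnS prednK.
Qed.

Lemma rhoE n : (0 < n)%N ->
  qint n *: sym_h Zq n = \sum_(i < n) sym_h Zq i * rho (n - i).
Proof.
case: n => // n _; rewrite -(big_mkord xpredT (fun i => sym_h Zq i * rho (n.+1 - i))).
rewrite big_ltn // subn0 sym_h0 mul1r /rho /= nth_rcons size_rho_seq ltnn eqxx.
rewrite [X in _ = _ - X + _]big_nat [X in _ = _ + X]big_nat.
rewrite [X in _ = _ - X + _](eq_bigr (fun i => sym_h Zq i * rho (n.+1 - i))) ?subrK //.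
move=> i /andP[i1 ltin]; congr (_ * _); apply: nth_rho_seq.
by rewrite subn_gt0 ltin leq_subLR -[n.+1]add1n leq_add2r.
Qed.

(* Here and below [n] is 'I_n, so all indices are shifted by 1. *)
Record hessenberg n := Hessenberg {
  hess_fun :> 'I_n -> 'I_n;
  hess_homo : {homo hess_fun : i j / (i <= j)%N};
  hess_ge : forall i : 'I_n, (i <= hess_fun i)%N
}.

Fact path_fun_subproof n (i : 'I_n) : (minn i.+1 n.-1 < n)%N.
Proof. by case: n i => [[]//|n i]; exact: leq_ltn_trans (geq_minr _ _) (ltnSn n). Qed.

Definition path_fun n (i : 'I_n) : 'I_n := Ordinal (path_fun_subproof i).

Fact path_fun_homo n : {homo @path_fun n : i j / (i <= j)%N}.
Proof. by move=> i j leij; rewrite /= leq_min !geq_min !ltnS leij leqnn orbT. Qed.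

Fact path_fun_ge n (i : 'I_n) : (i <= path_fun i)%N.
Proof. by case: n i => [[]//|n i]; rewrite /= leq_min leqnSn leq_ord. Qed.

Definition path_hess n : hessenberg n := Hessenberg (@path_fun_homo n) (@path_fun_ge n).

(* The elements that are the smallest of their cycle, in increasing order. *)
Definition cycle_mins n (s : 'S_n) : seq 'I_n :=
  [seq x : 'I_n <- enum 'I_n | all (fun y : 'I_n => x <= y)%N (fingraph.orbit s x)].

(* fingraph.orbit s x is [:: x; s x; s (s x); ...], that is, the cycle of s that
   starts at x. *)
Definition cycles n (s : 'S_n) : seq (seq 'I_n) :=
  [seq fingraph.orbit s x | x <- cycle_mins s].

Fact mem_flatten_cycles n (s : 'S_n) x : x \in flatten (cycles s).
Proof.
pose y := [arg min_(y < x in fingraph.orbit s x) (y : nat)].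
have [yx ymin] : y \in fingraph.orbit s x /\ forall z, z \in fingraph.orbit s x -> (y <= z)%N.
  by rewrite /y; case: arg_minnP => [|z zx zmin]; first exact: in_orbit.
have syx : fconnect s y x by rewrite fconnect_sym; [rewrite fconnect_orbit|exact: perm_inj].
apply/flattenP; exists (fingraph.orbit s y); last by rewrite -fconnect_orbit.
apply: map_f; rewrite mem_filter mem_enum andbT; apply/allP => z; rewrite -fconnect_orbit => yz.
apply: ymin; rewrite -fconnect_orbit; apply: connect_trans yz.
by rewrite fconnect_sym //; exact: perm_inj.
Qed.

Fact uniq_flatten_cycles n (s : 'S_n) : uniq (flatten (cycles s)).
Proof.
rewrite (_ : flatten _ = [seq y | x <- cycle_mins s, y <- fingraph.orbit s x]); last first.
  by rewrite /cycles; congr flatten; apply: eq_map => x; rewrite map_id.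
apply: allpairs_uniq_dep => [|x _|].
- by rewrite filter_uniq ?enum_uniq.
- exact: orbit_uniq.
move=> _ _ /allpairsPdep[x [z [+ zx ->]]] /allpairsPdep[x' [z' [+ zx' ->]]] /= ezz.
rewrite -{}ezz in zx' *; rewrite !mem_filter => /andP[/allP xmin _] /andP[/allP xmin' _].
suff -> : x = x' by [].
rewrite -!fconnect_orbit in zx zx'.
have cxx' : fconnect s x x'.
  by apply: connect_trans zx _; rewrite fconnect_sym //; exact: perm_inj.
have cx'x : fconnect s x' x by rewrite fconnect_sym //; exact: perm_inj.
apply/val_inj/eqP; rewrite eqn_leq xmin ?xmin' -?fconnect_orbit //.
Qed.

Fact size_flatten_cycles n (s : 'S_n) : size (flatten (cycles s)) = n.
Proof.
rewrite -(card_uniqP (uniq_flatten_cycles s)) -[RHS]card_ord.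
by apply: eq_card => x; rewrite mem_flatten_cycles.
Qed.

Fact one_line_inj n (s : 'S_n) : injective (fun i : 'I_n => nth i (flatten (cycles s)) i).
Proof.
move=> i j eij; apply/val_inj/eqP; move/eqP: eij.
rewrite (set_nth_default j i) ?size_flatten_cycles //.
by rewrite nth_uniq ?size_flatten_cycles ?uniq_flatten_cycles.
Qed.

(* The permutation whose one-line notation is the concatenation of the cycles. *)
Definition erase_parentheses n (s : 'S_n) : 'S_n := perm (@one_line_inj n s).

Definition S_hess n (m : hessenberg n) : {set 'S_n} := [set s : 'S_n | [forall i, s i <= m i]%N].

Definition wt_hess n (m : hessenberg n) (s : 'S_n) : nat :=
  let pos := ((erase_parentheses s)^-1)%g in
  #|[set p : 'I_n * 'I_n | [&& (p.1 < p.2)%N, (p.2 <= m p.1)%N & (pos p.2 < pos p.1)%N]]|.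

(* The exponent |tau_1| - n + k is written t1 + k - n since subtraction on nat is
   truncated; the condition n - k <= t1 makes the two agree. *)
Definition g_sym k n (m : hessenberg n) : Lambda :=
  \sum_(s in S_hess m | (n - k <= size (head [::] (cycles s)))%N)
    let t1 := size (head [::] (cycles s)) in
    ((-1) ^+ (t1 + k - n) * q ^+ wt_hess m s) *:
      (sym_h Zq (t1 + k - n) *
        omega Zq (\prod_(t <- behead (cycles s)) rho (size t))).

Definition is_partition k (la : seq nat) : bool :=
  [&& sorted geq la, all (fun i => 0 < i)%N la & sumn la == k].

(* A partition of k has at most k parts, each of them at most k. *)
Definition partitions k : seq (seq nat) :=
  [seq la <- [seq map val (l : seq 'I_k.+1) | l : k.-bseq 'I_k.+1] | is_partition k la].

Lemma mem_partitions k la : (la \in partitions k) = is_partition k la.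
Proof.
rewrite mem_filter andb_idr // => /and3P[_ la_gt0 /eqP sla].
have lelk i : (i \in la) -> (i <= k)%N.
  rewrite -sla => /perm_to_rem/perm_sumn -> /=; exact: leq_addr.
have szla : (size (map inord la : seq 'I_k.+1) <= k)%N.
  rewrite size_map -{}sla {lelk}; elim: la la_gt0 => //= x s IHs /andP[x0 /IHs les].
  by rewrite -add1n leq_add.
apply/mapP; exists (Bseq szla); first by rewrite mem_enum.
rewrite /= -map_comp -[LHS]map_id; apply/eq_in_map => i /lelk leik /=.
by rewrite inordK.
Qed.

Lemma partitions_uniq k : uniq (partitions k).
Proof.
apply: filter_uniq; rewrite map_inj_uniq ?enum_uniq // => l l' /inj_map ell.
exact/val_inj/ell/val_inj.
Qed.

Definition derangements (w : seq nat) : seq (seq nat) :=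
  [seq v <- permutations w | all2 (fun a b => a != b) v w].

Lemma mem_derangements w v :
  (v \in derangements w) = perm_eq v w && all2 (fun a b => a != b) v w.
Proof. by rewrite mem_filter mem_permutations andbC. Qed.

Lemma derangements_uniq w : uniq (derangements w).
Proof. exact/filter_uniq/permutations_uniq. Qed.

Definition exc (w v : seq nat) : nat :=
  #|[set j : 'I_(size w) | (nth 0 w j < nth 0 v j)%N]|.

(* The word 1^la_1 2^la_2 ... l^la_l. *)
Definition part_word (la : seq nat) : seq nat :=
  flatten [seq nseq (nth 0%N la i) i.+1 | i <- iota 0 (size la)].

Definition c_part (la : seq nat) : Zq :=
  \sum_(v <- derangements (part_word la)) q ^+ exc (part_word la) v.

(* Main.v *)
Require Import Defs.
From mathcomp Require Import all_boot all_order all_fingroup all_algebra.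
From mathcomp Require Import mpoly zify.

Import GRing.Theory.
Local Open Scope ring_scope.

(* A permutation [s] with [s i <= i + 1] is a product of cycles [(a a+1 ... b)] on
   consecutive intervals, so it has weight 0 and corresponds to a composition of
   [N]; hence [g_k] is an explicit sum over compositions, and its generating series
   is [(1 - q) / (E(qz) - q E(z))], i.e. [\sum_i (q^i - q) e_i g_(k-i) = 0] for
   [k > 0].  On the other side, [c_part] of a content [a] is the coefficient of
   [x^a] in [\prod_i L_i^a_i] with [L_i = \sum_(j < i) x_j + q \sum_(j > i) x_j]
   (MacMahon).  The telescoping identity
   [q \prod_i (L_i + x_i) = \prod_i (L_i + q x_i)] shows that these coefficients
   satisfy the same recurrence, which determines them. *)

Local Notation Zq := {poly int}.
Local Notation Lambda := (symfun Zq).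
Local Notation h := (sym_h Zq).
Local Notation e := (sym_e Zq).

(** * Permutations for the path graph *)

Lemma mem_cycle_mins n (s : 'S_n) x :
  (x \in cycle_mins s) = all (fun y : 'I_n => x <= y)%N (fingraph.orbit s x).
Proof. by rewrite mem_filter mem_enum andbT. Qed.

Lemma orbit_path_hess N (s : 'S_N) x : s \in S_hess (path_hess N) -> x \in cycle_mins s ->
  map val (fingraph.orbit s x) = iota x (fingraph.order s x).
Proof.
rewrite inE mem_cycle_mins => /forallP sP /allP xmin.
(* The next element is at most the previous one plus 1, at least [x], and new. *)
have itE i : (i < fingraph.order s x)%N -> iter i s x = (x + i)%N :> nat.
  elim/ltn_ind: i => -[|i] IHi lti; first by rewrite addn0.
  have := sP (iter i s x); rewrite /= IHi ?ltnS //; last exact: ltnW.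
  have := xmin (iter i.+1 s x); rewrite -fconnect_orbit fconnect_iter => /(_ isT) /=.
  rewrite leq_min => lex /andP[le1 _].
  have [ltj|ltj|//] := ltngtP (s (iter i s x) : nat) (x + i.+1)%N; last first.
    by move: ltj; rewrite addnS ltnNge le1.
  (* A smaller value would be [x + j] with [j <= i], which the iterate of index [j] has already
     taken. *)
  set j := (s (iter i s x) - x)%N.
  have ltji : (j < i.+1)%N by rewrite /j; lia.
  have := IHi j ltji (ltn_trans ltji lti).
  rewrite /j subnKC // => /val_inj/(congr1 (findex s x)).
  rewrite findex_iter ?(ltn_trans ltji) //.
  rewrite -[s (iter i s x)]/(iter i.+1 s x) findex_iter // => eji.
  by move: ltji; rewrite -/j /j eji ltnn.
apply: (@eq_from_nth _ 0%N) => [|i]; first by rewrite size_map size_orbit size_iota.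
rewrite size_map size_orbit => lti; rewrite nth_iota // -itE //.
by rewrite (nth_map x) ?size_orbit // nth_traject.
Qed.

(** The cycles are intervals listed by increasing minimum, and they do not interleave: if the
    interval from [x] reached the minimum [x'] of a later cycle, [x'] would lie in the cycle of [x].
    Hence the flattened list is strictly increasing, with all of ['I_N] as members. *)
Lemma flatten_cycles_path_hess N (s : 'S_N) : s \in S_hess (path_hess N) ->
  flatten (cycles s) = enum 'I_N.
Proof.
move=> sP; apply: (inj_map val_inj); rewrite val_enum_ord.
apply: (irr_sorted_eq ltn_trans ltnn); last first.
- move=> i; rewrite mem_iota add0n /=; apply/mapP/idP => [[x _ ->]//|ltin].
  by exists (Ordinal ltin) => //; exact: mem_flatten_cycles.
- exact: iota_ltn_sorted.
(* Trivial now, this inclusion keeps membership in [cycle_mins s] available during the induction on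
   the list. *)
have : {subset cycle_mins s <= cycle_mins s} by [].
have : sorted (fun x y : 'I_N => x < y)%N (cycle_mins s).
  apply: sorted_filter => [y x z|]; first exact: ltn_trans.
  by have := iota_ltn_sorted 0 N; rewrite -val_enum_ord sorted_map.
rewrite (sorted_pairwise ltn_trans) /cycles.
elim: {1 2 4}(cycle_mins s) => //= x ms IHms.
rewrite path_sortedE => [/andP[ltx ms_sorted] msP|y1 y2 y3]; last exact: ltn_trans.
have xm : x \in cycle_mins s by apply: msP; rewrite mem_head.
rewrite map_cat pairwise_cat IHms ?andbT //; last first.
  by move=> y ym; apply: msP; rewrite inE ym orbT.
rewrite orbit_path_hess // -sorted_pairwise ?iota_ltn_sorted ?andbT //; last exact: ltn_trans.
apply/allrelP => y _ + /mapP[z /flattenP[_ /mapP[x' x'm ->]] zx' ->].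
rewrite mem_iota => /andP[lexy ltyx]; rewrite ltnNge; apply/negP => lezy.
have := allP ltx _ x'm; rewrite ltnNge => /negP; apply.
have x'min : x' \in cycle_mins s by apply: msP; rewrite inE x'm orbT.
have lt' : (x < x')%N := allP ltx _ x'm.
have lex'z : (x' <= z)%N by move: x'min; rewrite mem_cycle_mins => /allP/(_ _ zx').
have : val x' \in iota x (fingraph.order s x).
  by rewrite mem_iota (ltnW lt') /= (leq_ltn_trans lex'z) // (leq_ltn_trans lezy).
rewrite -orbit_path_hess // (mem_map val_inj) -fconnect_orbit.
rewrite fconnect_sym; last exact: perm_inj.
by rewrite fconnect_orbit; move: x'min; rewrite mem_cycle_mins => /allP; apply.
Qed.

(** Erasing the parentheses yields the identity, which has no inversions. *)
Lemma wt_path_hess N (s : 'S_N) : s \in S_hess (path_hess N) -> wt_hess (path_hess N) s = 0%N.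
Proof.
move=> sP; rewrite /wt_hess (_ : erase_parentheses s = 1%g); last first.
  by apply/permP => i; rewrite permE flatten_cycles_path_hess // nth_ord_enum perm1.
apply: eq_card0 => -[i j]; rewrite inE invg1 !perm1 /=.
by case: ltngtP => //; rewrite andbF.
Qed.

(** The image of [x] is its cyclic successor in the listed cycle that contains it. *)
Lemma cycles_inj n : injective (@cycles n).
Proof.
move=> s s' ess; apply/permP => x.
have /flattenP[c cs xc] := mem_flatten_cycles s x.
have fc (t : 'S_n) : c \in cycles t -> t x = next c x.
  case/mapP=> y _ cE; apply/eqP; apply: (@next_cycle _ (frel t)) => //.
  by rewrite cE; exact/cycle_orbit/perm_inj.
by rewrite !fc // -ess.
Qed.

(** All these permutations share one flattened cycle list, so the block lengths alone recover the
    cycles. *)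
Lemma shape_cycles_path_inj N :
  {in S_hess (path_hess N) &, injective (fun s => shape (cycles s))}.
Proof.
move=> s s' sP s'P ess; apply: cycles_inj.
by rewrite -[LHS]flattenK -[RHS]flattenK ess !flatten_cycles_path_hess.
Qed.

Lemma nth_find_block (T : eqType) (bs : seq (seq T)) b x : uniq (flatten bs) ->
  b \in bs -> x \in b -> nth [::] bs (find (fun c => x \in c) bs) = b.
Proof.
elim: bs => //= c bs IHbs; rewrite cat_uniq => /and3P[_ /hasPn dis ubs].
rewrite inE => /predU1P[->->//|bbs xb].
have /negbTE-> : x \notin c by apply: dis; apply/flattenP; exists b.
exact: IHbs.
Qed.

Lemma flatten_iota_block (bs : seq (seq nat)) b m l :
  flatten bs = iota m l -> b \in bs -> exists m', b = iota m' (size b).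
Proof.
elim: bs m l => //= c bs IHbs m l cE.
have lec : (size c <= l)%N by rewrite -(size_iota m l) -cE size_cat leq_addr.
have := cE; rewrite -(subnKC lec) iotaD => /eqP.
rewrite eqseq_cat ?size_iota // => /andP[/eqP eqc /eqP eqbs].
by rewrite inE => /predU1P[->|]; [exists m|exact: IHbs eqbs].
Qed.

Lemma heads_subseq (T : eqType) (x0 : T) (bs : seq (seq T)) : [::] \notin bs ->
  subseq (map (head x0) bs) (flatten bs).
Proof.
elim: bs => //= -[|x b] bs IHbs; first by rewrite mem_head.
rewrite inE => /norP[_ /IHbs sub]; rewrite /= eqxx.
exact: subseq_trans sub (suffix_subseq _ _).
Qed.

Lemma shape_cycles_path_surj N (al : seq nat) : sumn al = N -> 0%N \notin al ->
  exists2 s, s \in S_hess (path_hess N) & shape (cycles s) = al.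
Proof.
move=> sal al0; pose bs := reshape al (enum 'I_N).
have flbs : flatten bs = enum 'I_N by rewrite reshapeKr // size_enum_ord sal.
have shbs : shape bs = al by rewrite reshapeKl // size_enum_ord sal.
have ubs : uniq (flatten bs) by rewrite flbs enum_uniq.
have bs0 : [::] \notin bs.
  by apply: contra al0 => bs0; rewrite -shbs; apply/mapP; exists [::].
have inbs x : exists2 b, b \in bs & x \in b.
  by apply/flattenP; rewrite flbs mem_enum.
(* [s] permutes cyclically the blocks of lengths [al]. *)
pose blk x := nth [::] bs (find (fun c => x \in c) bs).
have blkE b x : b \in bs -> x \in b -> blk x = b by exact: nth_find_block.
have bU b : b \in bs -> uniq b.
  elim: (bs) ubs => //= c cs IHcs; rewrite cat_uniq => /and3P[uc _ /IHcs uf].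
  by rewrite inE => /predU1P[->|].
have f_inj : injective (fun x => next (blk x) x).
  apply: (@can_inj _ _ _ (fun x => prev (blk x) x)) => x; have [b bbs xb] := inbs x.
  by rewrite (blkE b) // (blkE b) ?mem_next // prev_next // bU.
pose s : 'S_N := perm f_inj.
have sE b x : b \in bs -> x \in b -> s x = next b x.
  by move=> bbs xb; rewrite permE (blkE b).
have bI b : b \in bs -> exists m, map val b = iota m (size b).
  move=> bbs; rewrite -(size_map val b).
  apply: (@flatten_iota_block (map (map val) bs) _ 0 N); last exact: map_f.
  by rewrite -map_flatten flbs val_enum_ord.
have sP : s \in S_hess (path_hess N).
  rewrite inE; apply/forallP => x; rewrite /= leq_min -(ltnS _ N.-1) (ltn_predK (ltn_ord x)).
  rewrite ltn_ord andbT.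
  have [b bbs xb] := inbs x; rewrite (sE b) // next_nth xb.
  have [m mE] := bI b bbs.
  have nb y i : (i < size b)%N -> nth y b i = (m + i)%N :> nat.
    by move=> lti; rewrite -(nth_map _ 0%N val) // mE nth_iota.
  case: b xb bbs mE nb => // y b xb bbs mE nb.
  set i := index x (y :: b); have lti : (i < (size b).+1)%N.
    by rewrite -[(size b).+1]/(size (y :: b)) index_mem.
  have xE : x = (m + i)%N :> nat by rewrite -(nb x) // nth_index.
  (* [next_nth] reads the tail of the block with its head as default value, so the last element, at
     index [size b], is sent back to the head. *)
  case: (ltnP i (size b)) => [lti'|lei].
    by rewrite -[nth y b i]/(nth y (y :: b) i.+1) nb // xE addnS.
  by rewrite nth_default // xE -[y]/(nth y (y :: b) 0) nb // addn0 ltnW // ltnS leq_addr.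
exists s => //; rewrite -shbs; congr shape; rewrite /cycles.
have orb b x : b \in bs -> x \in b -> fingraph.orbit s x = rot (index x b) b.
  move=> bbs xb; have fcb : fcycle s b.
    rewrite (eq_in_cycle (P := mem b) (e' := frel (next b))) ?(cycle_next (bU b bbs)) //.
    by move=> z t zb tb; rewrite /= (sE b).
  exact: (fingraph.orbitE fcb (bU b bbs) xb).
have hE x0 b : b \in bs -> fingraph.orbit s (head x0 b) = b.
  move=> bbs; have b_neq0 : b != [::] by apply: contra bs0 => /eqP <-.
  by rewrite (orb b) //; case: b b_neq0 {bbs} => //= y b _; rewrite ?eqxx ?rot0 ?mem_head.
(* [head] needs a default element; if ['I_N] is empty, both lists are empty. *)
have [x0 _|no0] := pickP (@predT 'I_N); last first.
  have nil0 (l : seq 'I_N) : l = [::] by case: l => // x; have := no0 x.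
  rewrite [cycle_mins s]nil0; case: (bs) bs0 => //= b bs'.
  by rewrite [b]nil0 mem_head.
rewrite [RHS](_ : _ = map (fingraph.orbit s) (map (head x0) bs)); last first.
  by rewrite -map_comp map_id_in // => b bbs; exact: hE.
congr map; pose lto := fun x y : 'I_N => (x < y)%N.
have lto_trans : transitive lto by move=> y x z; exact: ltn_trans.
have enum_sorted : sorted lto (enum 'I_N).
  by have := iota_ltn_sorted 0 N; rewrite -val_enum_ord sorted_map.
(* Both lists are strictly increasing, so it suffices that the cycle minima and the block heads are
   the same elements. *)
apply: (irr_sorted_eq lto_trans) => [x|||x]; first exact: ltnn.
- exact: sorted_filter.
- by apply: (subseq_sorted lto_trans _ enum_sorted); rewrite -flbs; exact: heads_subseq.
have head_min b : b \in bs -> {in b, forall y : 'I_N, (head x0 b <= y)%N}.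
  move=> bbs; have [m mE] := bI b bbs => y yb.
  have yI : val y \in iota m (size b) by rewrite -mE; exact: map_f.
  case: b bbs mE yb yI => // z b bbs mE _; rewrite mem_iota => /andP[lemy _].
  by case: mE => -> _.
rewrite mem_cycle_mins; apply/allP/mapP => [xmin|[b bbs ->] y]; last first.
  by rewrite hE // => /head_min->.
have [b bbs xb] := inbs x; exists b => //; apply/val_inj/eqP; rewrite eqn_leq head_min // andbT.
apply: xmin; rewrite (orb b) // mem_rot.
by case: b bbs {xb} => [|y b]; rewrite ?mem_head // (negbTE bs0).
Qed.

(** * Compositions and an explicit formula for g_k *)

(** These are the compositions of [N]. Listing them as images of permutations turns the sum over
    [S_hess] into a sum over compositions. *)
Definition path_shapes N : seq (seq nat) :=
  [seq shape (cycles s) | s : 'S_N in S_hess (path_hess N)].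

Lemma mem_path_shapes N al : (al \in path_shapes N) = (sumn al == N) && (0%N \notin al).
Proof.
apply/mapP/andP => [[s _ ->]|[/eqP sal al0]]; last first.
  by have [s sP <-] := shape_cycles_path_surj N al sal al0; exists s => //; rewrite mem_enum.
rewrite -size_flatten size_flatten_cycles; split=> //; apply/mapP => -[_ /mapP[x _ ->]].
by apply/eqP; rewrite size_orbit eq_sym -lt0n fingraph.order_gt0.
Qed.

Lemma path_shapes_uniq N : uniq (path_shapes N).
Proof.
rewrite map_inj_in_uniq ?enum_uniq // => s s'; rewrite !mem_enum.
exact: shape_cycles_path_inj.
Qed.

Lemma path_shapes_rec N : (0 < N)%N ->
  perm_eq (path_shapes N) [seq j :: al | j <- iota 1 N, al <- path_shapes (N - j)].
Proof.
move=> N_gt0; apply: uniq_perm; first exact: path_shapes_uniq.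
  apply: allpairs_uniq_dep => [|j _|]; [exact: iota_uniq|exact: path_shapes_uniq|].
  by move=> [j al] [j' al'] _ _ /= [-> ->].
move=> al; rewrite mem_path_shapes; apply/andP/allpairsPdep => [[]|].
  case: al => [|j al] /=; first by case: (N) N_gt0.
  rewrite inE negb_or => /eqP sal /andP[j0 al0].
  exists j, al; split=> //; first by rewrite mem_iota; move: sal j0; lia.
  by rewrite mem_path_shapes al0 andbT -sal addKn.
move=> [j [be [+ + ->]]]; rewrite mem_iota mem_path_shapes /= inE negb_or.
by move=> jP /andP[/eqP-> ->]; split; move: jP; lia.
Qed.

Lemma path_shapes0 : path_shapes 0 = [:: [::]].
Proof.
apply: perm_small_eq => //; apply: uniq_perm => //; first exact: path_shapes_uniq.
move=> al; rewrite mem_path_shapes inE; case: al => //= j al.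
by case: j => [|j]; rewrite ?inE ?eqxx ?andbF.
Qed.

(** The coefficient of z^m in 1 / (1 - R(z)), where R(z) is the sum over j >= 1 of omega(rho_j)
    z^j. *)
Definition rho_comps m : Lambda :=
  \sum_(al <- path_shapes m) \prod_(t <- al) omega Zq (rho t).

Lemma rho_comps0 : rho_comps 0 = 1.
Proof. by rewrite /rho_comps path_shapes0 big_seq1 big_nil. Qed.

Lemma rho_comps_rec m : (0 < m)%N ->
  rho_comps m = \sum_(1 <= j < m.+1) omega Zq (rho j) * rho_comps (m - j).
Proof.
move=> m_gt0; rewrite /rho_comps (perm_big _ (path_shapes_rec m m_gt0)) big_allpairs_dep /=.
rewrite /index_iota subn1; apply: eq_bigr => j _; rewrite mulr_sumr.
by apply: eq_bigr => al _; rewrite big_cons.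
Qed.

(** The first part [j] of the composition is at least [N - k]. Writing [j = i + (N - k)], the other
    parts form a composition of [k - i], and [N] disappears. *)
Lemma g_sym_path k N : (k < N)%N ->
  g_sym k (path_hess N) = \sum_(i < k.+1) (-1) ^+ i *: (h i * rho_comps (k - i)).
Proof.
move=> lt_kN; pose F (al : seq nat) : Lambda :=
  (-1) ^+ (head 0 al + k - N)%N *:
    (h (head 0 al + k - N) * \prod_(t <- behead al) omega Zq (rho t)).
transitivity (\sum_(al <- path_shapes N | (N - k <= head 0 al)%N) F al).
  rewrite big_map big_enum_cond; apply: eq_big => [s|s /andP[sP _]].
    by case: (cycles s).
  rewrite /= wt_path_hess // expr0 mulr1 rmorph_prod /F /=.
  by case: (cycles s) => [|c cs] /=; rewrite ?big_nil // big_map.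
rewrite (perm_big _ (path_shapes_rec N _)) ?(leq_ltn_trans _ lt_kN) //.
rewrite big_mkcond big_allpairs_dep /=.
have -> : iota 1 N = index_iota 1 N.+1 by rewrite /index_iota subn1.
transitivity (\sum_(1 <= j < N.+1) if (N - k <= j)%N then
    (-1) ^+ (j + k - N)%N *: (h (j + k - N) * rho_comps (N - j)) else 0).
  apply: eq_bigr => j _; case: leqP => _; last by rewrite big1.
  by rewrite /F /= -scaler_sumr -mulr_sumr.
rewrite (big_cat_nat _ (n := (N - k)%N)) /= ?subn_gt0 //; last by rewrite ltnW // ltnS leq_subr.
rewrite big_nat big1 ?add0r => [|j /andP[_ ltj]]; last by rewrite leqNgt ltj.
rewrite -{1}[(N - k)%N]add0n big_addn big_mkord (_ : (N.+1 - (N - k) = k.+1)%N); last by lia.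
apply: eq_bigr => i _; rewrite leq_addl; have -> : (i + (N - k) + k - N = i)%N by lia.
by have -> : (N - (i + (N - k)) = k - i)%N by have := ltn_ord i; lia.
Qed.

(** * The generating series of the [g_k] *)

(** The Cauchy product: sequences stand for formal power series. *)
Definition conv {A : comNzRingType} (u v : nat -> A) k := \sum_(i < k.+1) u i * v (k - i)%N.

Lemma eq_conv {A : comNzRingType} (u u' v v' : nat -> A) k :
  u =1 u' -> v =1 v' -> conv u v k = conv u' v' k.
Proof. by move=> eu ev; apply: eq_bigr => i _; rewrite eu ev. Qed.

(** Truncation turns [conv] into a product of polynomials, from which it inherits commutativity and
    associativity. *)
Lemma conv_coef {A : comNzRingType} (u v : nat -> A) k j : (j <= k)%N ->
  conv u v j = ((\poly_(i < k.+1) u i) * (\poly_(i < k.+1) v i))`_j.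
Proof.
move=> lejk; rewrite coefM; apply: eq_bigr => i _.
by rewrite !coef_poly !ltnS (leq_trans (leq_subr _ _) lejk) (leq_trans _ lejk) // -ltnS.
Qed.

Lemma convC {A : comNzRingType} (u v : nat -> A) k : conv u v k = conv v u k.
Proof. by rewrite !(conv_coef _ _ k) // mulrC. Qed.

Lemma convA {A : comNzRingType} (u v w : nat -> A) k :
  conv u (conv v w) k = conv (conv u v) w k.
Proof.
pose p (f : nat -> A) := \poly_(i < k.+1) f i.
transitivity ((p u * (p v * p w))`_k); last rewrite mulrA.
- rewrite coefM; apply: eq_bigr => i _; rewrite coef_poly ltn_ord; congr (_ * _).
  by rewrite (conv_coef _ _ k) ?leq_subr.
- rewrite coefM; apply: eq_bigr => i _; rewrite coef_poly ltnS leq_subr; congr (_ * _).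
  by rewrite (conv_coef _ _ k) // -ltnS.
Qed.

Lemma conv1 {A : comNzRingType} (u : nat -> A) k : conv (fun i => (i == 0%N)%:R) u k = u k.
Proof.
by rewrite /conv big_ord_recl mul1r subn0 big1 ?addr0 // => i _; rewrite mul0r.
Qed.

(** The common value of [g_sym k (path_hess N)] over all [N > k]. *)
Definition g_path k : Lambda := \sum_(i < k.+1) (-1) ^+ i *: (h i * rho_comps (k - i)).

Lemma g_path0 : g_path 0 = 1.
Proof. by rewrite /g_path big_ord1 scale1r sym_h0 mul1r rho_comps0. Qed.

(* With [H], [E] the generating series of the [h_n], [e_n], the generating series
   of the [rho_n] is [(H(z) - H(qz)) / ((1 - q) H(z))], hence that of [g_path] is
   [H(-z) (1 - q) E(z) / (E(qz) - q E(z)) = (1 - q) / (E(qz) - q E(z))]. *)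
Lemma g_path_rec k : (0 < k)%N ->
  \sum_(i < k.+1) ('X ^+ i - 'X) *: (e i * g_path (k - i)) = 0.
Proof.
move=> k_gt0.
(* As series, [d] is 1, [h'] is H(-z), and [r] is R(z), with constant term 0. *)
pose d i : Lambda := (i == 0%N)%:R; pose h' i : Lambda := (-1) ^+ i *: h i.
pose r j : Lambda := if j is 0 then 0 else omega Zq (rho j).
have eh' : conv h' e =1 d.
  case=> [|j]; first by rewrite /conv big_ord1 /h' scale1r sym_h0 sym_e0 mul1r.
  by apply: (etrans _ (sym_he Zq (ltn0Sn j))); apply: eq_bigr => i _; rewrite -scalerAl.
have gE : g_path =1 conv h' rho_comps.
  by move=> j; apply: eq_bigr => i _; rewrite -scalerAl.
have rE : conv r rho_comps =1 (fun j => rho_comps j - d j).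
  case=> [|j]; first by rewrite /conv big_ord1 mul0r rho_comps0 subrr.
  rewrite subr0 rho_comps_rec // /conv big_ord_recl mul0r add0r.
  by rewrite big_add1 big_mkord.
(* The image under [omega] of the recursion for [rho], multiplied by 1 - q so that [qint i] becomes
   1 - q^i. *)
have er i : (1 - 'X) *: conv e r i = (1 - 'X ^+ i) *: e i.
  case: i => [|i]; first by rewrite /conv big_ord1 mulr0 subrr scale0r scaler0.
  rewrite /conv big_ord_recr /= subnn mulr0 addr0.
  have /(congr1 (omega Zq)) := rhoE (ltn0Sn i).
  rewrite linearZ /= omega_h raddf_sum /= => eq_e.
  rewrite (eq_bigr (fun j : 'I_i.+1 => omega Zq (h j * rho (i.+1 - j)))) => [|j _].
    by rewrite -eq_e scalerA /qint -opprB mulNr -subrX1 opprB.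
  by rewrite rmorphM /= omega_h /r subSn // -ltnS.
have eg : conv e g_path =1 rho_comps.
  move=> j; rewrite (eq_conv _ _ _ _ _ (frefl e) gE) convA.
  by rewrite (eq_conv _ d _ rho_comps) ?conv1 // => i; rewrite convC eh'.
have reg : conv (conv e r) g_path k = rho_comps k - d k.
  rewrite -convA convC -convA -rE; apply: eq_conv => // j.
  by rewrite convC eg.
(* Since q^i - q = (1 - q) - (1 - q^i), the sum is 1 - q times a difference equal to [d k], which
   vanishes for k > 0. *)
transitivity ((1 - 'X) *: (conv e g_path k - conv (conv e r) g_path k)).
  rewrite /conv -sumrB scaler_sumr; apply: eq_bigr => i _.
  rewrite scalerBr (scalerAl (1 - 'X) (conv e r i)) er -scalerAl -scalerBl; congr (_ *: _).
  by rewrite opprB [RHS]addrC addrA subrK.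
by rewrite eg reg opprB addrCA subrr addr0 /d; case: (k) k_gt0 => // j _; rewrite scaler0.
Qed.

(** * Derangements as coefficients of products of linear forms *)

(** Vanishing at [x = y] kills every word that is not a derangement, so sums may range over all
    rearrangements. *)
Definition exc_weight (x y : nat) : Zq := if (x < y)%N then 'X else (y < x)%N%:R.

Lemma exc_cons x w y v : exc (x :: w) (y :: v) = ((x < y) + exc w v)%N.
Proof.
rewrite /exc -!sum1dep_card !big_mkcond /= big_ord_recl /=; congr addn.
by rewrite [RHS]big_mkcond.
Qed.

Lemma prod_exc_weight w v : size v = size w ->
  \prod_(p <- zip w v) exc_weight p.1 p.2
  = if all2 (fun a b => a != b) v w then 'X ^+ exc w v else 0.
Proof.
elim: w v => [|x w IHw] [|y v] //= => [_|[szv]].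
  by rewrite big_nil /exc eq_card0 // => -[].
rewrite big_cons IHw // exc_cons exprD /exc_weight /=.
by case: ltngtP => //=; rewrite ?mul0r //; case: ifP; rewrite ?mulr0 ?mul1r ?expr1.
Qed.

Lemma c_part_permutations la : let w := part_word la in
  c_part la = \sum_(v <- permutations w) \prod_(p <- zip w v) exc_weight p.1 p.2.
Proof.
move=> w; rewrite /c_part big_filter big_mkcond big_seq [RHS]big_seq.
apply: eq_bigr => v; rewrite mem_permutations => /perm_size szv.
by rewrite prod_exc_weight.
Qed.

Section LinearForms.
Variable n : nat.

(** The content [a] is arbitrary, not only a partition, because lowering parts in the recurrence may
    break the order or create zeros. *)
Definition mword (a : 'X_{1..n}) : seq 'I_n :=
  flatten [seq nseq (a i) i | i <- enum 'I_n].

Lemma part_word_mword (a : 'X_{1..n}) :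
  part_word a = [seq (val i).+1 | i <- mword a].
Proof.
rewrite /part_word /mword map_flatten size_tuple -val_enum_ord -!map_comp; congr flatten.
by apply: eq_map => i; rewrite /= map_nseq -mnm_nth.
Qed.

Lemma count_mword (a : 'X_{1..n}) i : count_mem i (mword a) = a i.
Proof.
rewrite count_flatten -map_comp sumnE big_map big_enum (bigD1 i) //= count_nseq /= eqxx mul1n.
by rewrite big1 ?addn0 // => j /negbTE ji; rewrite count_nseq /= ji.
Qed.

Lemma big_mword (R : comNzRingType) (a : 'X_{1..n}) (F : 'I_n -> R) :
  \prod_(i <- mword a) F i = \prod_i F i ^+ a i.
Proof.
rewrite big_flatten big_map big_enum; apply: eq_bigr => i _.
by rewrite big_nseq iter_mulr_1.
Qed.

(* [x_j] marks the replacement of a letter [i] of the word by [j]; [T] restricts the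
   alphabet to the letters that occur. *)
Definition exc_form (T : {set 'I_n}) (i : 'I_n) : {mpoly Zq[n]} :=
  \sum_(j in T) exc_weight i j *: 'X_j.

(** Expanding the product chooses a new letter [f k] at each position [k] of the word; the monomial
    x^a selects the choices that are rearrangements. *)
Lemma c_part_coeff (T : {set 'I_n}) (a : 'X_{1..n}) : (forall i, (0 < a i)%N -> i \in T) ->
  c_part a = (\prod_i exc_form T i ^+ a i)@_a.
Proof.
move=> aT; rewrite c_part_permutations -big_mword.
set W := mword a; pose W_ := tnth (in_tuple W); pose m := size W.
pose g (i : 'I_n) := (val i).+1.
pose word (f : {ffun 'I_m -> 'I_n}) := [seq g (f k) | k <- enum 'I_m].
pose deg (f : {ffun 'I_m -> 'I_n}) : 'X_{1..n} := (\sum_k U_(f k))%MM.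
have WE : W = [seq W_ k | k <- enum 'I_m] by rewrite map_tnth_enum.
have degE f i : deg f i = count_mem i [seq f k | k <- enum 'I_m].
  rewrite mnm_sumE count_map -sum1_count big_enum_cond [RHS]big_mkcond /=.
  by apply: eq_bigr => k _; rewrite mnm1E; case: eqP.
have wordE : part_word a = [seq g (W_ k) | k <- enum 'I_m].
  by rewrite part_word_mword -/W {1}WE -map_comp.
have word_inj : injective word.
  move=> f f' /eq_in_map eqf; apply/ffunP => k.
  by have /eqP := eqf k (mem_enum _ k); rewrite eqSS => /eqP/val_inj.
rewrite (perm_big [seq word f | f in [pred f | deg f == a]]); last first.
  apply: uniq_perm => [||v]; first exact: permutations_uniq.
    by rewrite map_inj_uniq ?enum_uniq.
  rewrite mem_permutations part_word_mword -/W; apply/idP/mapP => [|[f]].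
    move/(@tuple_permP _ _ _ (map_tuple g (in_tuple W))) => [p ->].
    pose f := [ffun k : 'I_m => W_ (p k)]; exists f; last first.
      by apply: eq_map => k; rewrite tnth_map ffunE.
    rewrite mem_enum inE; apply/eqP/mnmP => i; rewrite degE -count_mword.
    rewrite -/W [in RHS]WE [LHS]count_map [RHS]count_map.
    rewrite -!sum1_count !big_enum_cond [RHS](reindex_inj (@perm_inj _ p)) /=.
    by apply: eq_bigl => k; rewrite ffunE.
  rewrite mem_enum inE => /eqP fa ->; rewrite /word (map_comp g); apply: perm_map.
  apply/allP => i _ /=; apply/eqP.
  by rewrite -degE fa; exact/esym/count_mword.
rewrite big_map big_enum [in RHS]big_tnth /exc_form /=.
rewrite (bigA_distr_big (fun j => j \in T) (fun k j => exc_weight (W_ k) j *: 'X_j)) raddf_sum /=.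
rewrite big_mkcond [RHS]big_mkcond; apply: eq_bigr => f _.
rewrite wordE /word zip_map big_map big_enum /=.
rewrite scaler_prod mcoeffZ mprodXE mcoeffX -/(deg f) inE.
have [fa|_] := eqVneq (deg f) a; last by rewrite mulr0 if_same.
(* If [deg f] is [a], every value of [f] occurs in [a], so restricting the forms to [T] loses no
   term. *)
rewrite mulr1 ifT; last first.
  apply/ffun_onP => k; apply: aT; rewrite -fa degE -has_count has_pred1.
  by apply: map_f; rewrite mem_enum.
by apply: eq_bigr => k _.
Qed.

Lemma c_part_mnm0 : c_part (0%MM : 'X_{1..n}) = 1.
Proof.
rewrite (c_part_coeff setT) => [|i _]; last exact: in_setT.
by rewrite big1 => [|i _]; rewrite ?mcoeff1 ?eqxx // mnm0E.
Qed.

(* With [v m] the sum of the variables in which those of index at least [m] are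
   multiplied by [q], the factors are [v i.+1] on the left and [v i] on the right. *)
Lemma prod_exc_formD (T : {set 'I_n}) : T != set0 ->
  'X *: \prod_(i in T) (exc_form T i + 'X_i) = \prod_(i in T) (exc_form T i + 'X *: 'X_i).
Proof.
case/set0Pn => j0 j0T.
pose v m : {mpoly Zq[n]} := \sum_(j in T) (if (j < m)%N then 1 else 'X) *: 'X_j.
have v_neq0 m : v m != 0.
  apply/eqP => /(congr1 (fun p : {mpoly Zq[n]} => p@_U_(j0))).
  rewrite mcoeff0 raddf_sum (bigD1 j0) //= big1 => [|j /andP[_ /negbTE jj0]].
    rewrite addr0 mcoeffZ mcoeffX eqxx mulr1; apply/eqP.
    by case: ifP => _; rewrite ?oner_eq0 ?polyX_eq0.
  by rewrite mcoeffZ mcoeffX eq_mnm1 jj0 mulr0.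
have vS i : i \in T -> exc_form T i + 'X_i = v i.+1.
  move=> iT; rewrite /exc_form /v (bigD1 i) //= [RHS](bigD1 i) //= ltnSn.
  rewrite /exc_weight ltnn scale0r add0r scale1r addrC; congr (_ + _).
  by apply: eq_bigr => j /andP[_]; rewrite -val_eqE /= ltnS; case: ltngtP.
have vE i : i \in T -> exc_form T i + 'X *: 'X_i = v i.
  move=> iT; rewrite /exc_form /v (bigD1 i) //= [RHS](bigD1 i) //= ltnn.
  rewrite /exc_weight ltnn scale0r add0r addrC; congr (_ + _).
  by apply: eq_bigr => j /andP[_]; rewrite -val_eqE /=; case: ltngtP.
have vC i : i \notin T -> v i.+1 = v i.
  move=> iT; apply: eq_bigr => j jT; rewrite ltnS.
  by have : i != j by [apply: contra iT => /eqP->]; rewrite -val_eqE /=; case: ltngtP.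
have v0 : v 0%N = 'X *: v n.
  by rewrite scaler_sumr; apply: eq_bigr => j _; rewrite ltn_ord scale1r.
have tele : v 0%N * \prod_(i < n) v i.+1 = \prod_(i < n) v i * v n.
  by rewrite -(big_ord_recr n (fun i => v i)) big_ord_recl.
rewrite (eq_bigr _ vS) (eq_bigr _ vE).
(* The telescoping runs over all indices; [v n] and the factors outside [T], equal on both sides by
   [vC], are nonzero and cancel. *)
apply: (mulIf (v_neq0 n)); have Z_neq0 : \prod_(i | i \notin T) v i != 0.
  by apply/prodf_neq0 => i _; exact: v_neq0.
apply: (mulIf Z_neq0); move: tele.
rewrite (bigID (mem T)) /= [in RHS](bigID (mem T)) /= (eq_bigr _ vC) v0.
rewrite -!scalerAl [RHS]mulrAC => <-; congr (_ *: _).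
by rewrite [_ * v n]mulrC -mulrA.
Qed.

(** [S] collects the [i] for which c x_i is chosen in the modified factor. Dividing by x^S leaves
    the product for the content [a - mesym1 S]; its support may shrink, but [c_part_coeff] still
    applies with the original [T]. *)
Lemma coef_prod_exc_formD c (a : 'X_{1..n}) : let T := [set i | 0 < a i]%N in
  (\prod_(i in T) (exc_form T i ^+ (a i).-1 * (exc_form T i + c *: 'X_i)))@_a
  = \sum_(S : {set 'I_n} | (mesym1 S <= a)%MM) c ^+ #|S| * c_part (a - mesym1 S)%MM.
Proof.
move=> T; set L := exc_form T.
pose F i := if i \in T then c *: 'X_i * L i ^+ (a i).-1 else 0.
pose G i := if i \in T then L i ^+ a i else 1.
rewrite (_ : \prod_(i in T) _ = \prod_i (F i + G i)); last first.
  rewrite big_mkcond; apply: eq_bigr => i _; rewrite /F /G; case: ifP; rewrite ?add0r //.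
  rewrite inE mulrDr addrC => ai; congr (_ + _); first exact: mulrC.
  by rewrite -exprSr prednK.
rewrite bigA_distr raddf_sum [RHS]big_mkcond; apply: eq_bigr => S _.
case: ifPn => [leSa|nle]; last first.
  have [i iS iT] : exists2 i, i \in S & i \notin T.
    apply/exists_inP; apply: contraR nle; rewrite negb_exists_in => /forall_inP ST.
    apply/mnm_lepP => i; rewrite mnmE; case: (boolP (i \in S)) => // /ST.
    by rewrite negbK inE.
  by rewrite (bigD1 i) //= iS /F (negbTE iT) mul0r mcoeff0.
have ST i : i \in S -> (0 < a i)%N.
  by move=> iS; have /mnm_lepP/(_ i) := leSa; rewrite mnmE iS.
transitivity ((c ^+ #|S| *: (\prod_i L i ^+ (a - mesym1 S)%MM i * 'X_[mesym1 S]))@_a).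
  congr (_ @_ a); have SE : mesym1 S = (\sum_(i in S) U_(i))%MM.
    apply/mnmP => i; rewrite mnmE mnm_sumE big_mkcond (bigD1 i) //= mnm1E eqxx.
    rewrite big1 ?addn0 => [|j /negbTE ji]; first by case: (i \in S).
    by rewrite mnm1E ji if_same.
  rewrite [in X in _ *: (_ * X)]SE -mprodXE scalerAr -prodr_const -scaler_prod.
  rewrite [X in _ = _ * X]big_mkcond -big_split.
  apply: eq_bigr => i _ /=; rewrite mnmBE mnmE /F /G inE; case: ifP => [/ST ai|_].
    by rewrite ai subn1 mulrC.
  by rewrite mulr1 subn0; case: (a i).
rewrite mcoeffZ mcoeffMX_le leSa (c_part_coeff T) // => i; rewrite mnmBE inE.
by case: (a i).
Qed.
End LinearForms.

(* Compare the coefficients of [x^a] for [c = 1] and [c = q] in [coef_prod_exc_formD]. *)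
Lemma c_part_rec n (a : 'X_{1..n}) : (0 < mdeg a)%N ->
  \sum_(S : {set 'I_n} | (mesym1 S <= a)%MM) ('X ^+ #|S| - 'X) * c_part (a - mesym1 S)%MM = 0.
Proof.
move=> a_gt0; pose T := [set i | 0 < a i]%N.
have T0 : T != set0.
  apply: contraTneq a_gt0 => T0; rewrite -leqNgt mdegE leqn0 big1 // => i _; apply/eqP.
  by rewrite -leqn0 leqNgt; have := in_set0 i; rewrite -T0 inE => ->.
have := prod_exc_formD n T T0.
(* The extra factor brings both sides to the shape of [coef_prod_exc_formD]. *)
move/(congr1 (fun p => (\prod_(i in T) exc_form n T i ^+ (a i).-1 * p)@_a)).
rewrite -scalerAr mcoeffZ -!big_split /=.
have := coef_prod_exc_formD n 'X a; rewrite -/T /= => ->.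
have := coef_prod_exc_formD n 1 a; rewrite -/T /=; under eq_bigr do rewrite scale1r.
move=> ->; rewrite mulr_sumr => eq_q.
under eq_bigr do rewrite mulrBl; rewrite sumrB -eq_q.
by apply/eqP; rewrite subr_eq0; apply/eqP/eq_bigr => S _; rewrite expr1n mul1r.
Qed.

(** * Coefficients of g_k *)

(** Multiplying by e_i sums coefficients at the exponents [a - mesym1 S] with [#|S| = i], so
    [g_path_rec] becomes the recurrence [c_part_rec]. *)
Lemma g_path_coeff k n (a : 'X_{1..n}) :
  (sf_at n (g_path k))@_a = if mdeg a == k then c_part a else 0.
Proof.
elim/ltn_ind: k a => -[_|k IHk] a.
  rewrite g_path0 rmorph1 mcoeff1 mdeg_eq0; case: eqP => // ->.
  by rewrite c_part_mnm0.
pose P i (S : {set 'I_n}) := (#|S| == i) && (mesym1 S <= a)%MM.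
(* [X i] is the coefficient of x^a predicted for e_i g_(k+1-i); the case [i = 0] is the one to
   prove. *)
pose X i := if mdeg a == k.+1 then \sum_(S | P i S) c_part (a - mesym1 S)%MM else 0.
have P0 S : P 0%N S = (S == set0).
  rewrite /P cards_eq0; case: eqP => // ->.
  by apply/mnm_lepP => i; rewrite mesym1_set0 mnm0E.
have X0 : X 0%N = if mdeg a == k.+1 then c_part a else 0.
  by rewrite /X (eq_bigl _ _ P0) big_pred1_eq mesym1_set0 subm0.
have degS S : (mesym1 S <= a)%MM -> mdeg (a - mesym1 S)%MM = (mdeg a - #|S|)%N.
  by move=> /submK {2}<-; rewrite mdegD mdeg_mesym1 addnK.
have leS S : (mesym1 S <= a)%MM -> (#|S| <= mdeg a)%N.
  by move=> /submK <-; rewrite mdegD mdeg_mesym1 leq_addl.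
have cE : \sum_(i < k.+2) ('X ^+ i - 'X) * X i = 0.
  rewrite /X; have [da|_] := eqVneq (mdeg a) k.+1; last first.
    by apply: big1 => i _; rewrite mulr0.
  rewrite -[RHS](c_part_rec n a) ?da //.
  rewrite [RHS](partition_big (fun S : {set 'I_n} => inord #|S| : 'I_k.+2) xpredT) //=.
  apply: eq_bigr => i _; rewrite mulr_sumr.
  have PE S : (mesym1 S <= a)%MM && (inord #|S| == i) = P i S.
    rewrite /P andbC -val_eqE; case: (boolP (_ <= _)%MM) => [/leS leSa|_]; last by rewrite !andbF.
    by rewrite /= inordK // ltnS -da.
  by rewrite [RHS](eq_bigl _ _ PE); apply: eq_bigr => S /andP[/eqP-> _].
have gE (i : 'I_k.+2) : (sf_at n (sym_e Zq i * g_path (k.+1 - i)))@_a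
    = if (i == 0 :> nat) then (sf_at n (g_path k.+1))@_a else X i.
  rewrite rmorphM [X in (X * _)@_a]mesymE mulr_suml raddf_sum /=.
  rewrite (eq_bigr (fun S => if (mesym1 S <= a)%MM
      then (sf_at n (g_path (k.+1 - i)))@_(a - mesym1 S) else 0)) => [|S _]; last first.
    by rewrite mulrC mcoeffMX_le.
  rewrite -big_mkcondr -/(P i).
  case: eqP => [->|/eqP]; first by rewrite (eq_bigl _ _ P0) big_pred1_eq mesym1_set0 subm0 subn0.
  rewrite -lt0n => i_gt0; rewrite /X.
  rewrite (eq_bigr (fun S => if mdeg a == k.+1 then c_part (a - mesym1 S)%MM else 0))
      => [|S /andP[/eqP cS leSa]].
    by case: ifP => // _; rewrite big1.
  rewrite IHk; last by lia.
  rewrite degS // cS; congr (if _ then _ else _).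
  by have := leS S leSa; rewrite cS; have := ltn_ord i; lia.
have : \sum_(i < k.+2) ('X ^+ i - 'X) * (sf_at n (sym_e Zq i * g_path (k.+1 - i)))@_a = 0.
  transitivity (sf_at n (\sum_(i < k.+2) ('X ^+ i - 'X) *: (sym_e Zq i * g_path (k.+1 - i))))@_a.
    by rewrite !raddf_sum; apply: eq_bigr => i _; exact/esym/mcoeffZ.
  by rewrite g_path_rec // raddf0.
move/(fun E => etrans E (esym cE)); rewrite (eq_bigr _ (fun i _ => congr1 _ (gE i))).
(* The terms with [i > 0] agree; the remaining one has the factor 1 - q, which is nonzero as its
   value at q = 0 shows. *)
rewrite big_ord_recl [in RHS]big_ord_recl /= X0 => /addIr; apply: mulfI.
rewrite expr0 subr_eq0; apply/eqP => /(congr1 (fun p : Zq => p.[0])).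
by rewrite hornerX hornerC => /eqP.
Qed.

(** * Expansion in monomial symmetric functions *)

Lemma part_word_pad la m : part_word (la ++ nseq m 0%N) = part_word la.
Proof.
rewrite /part_word size_cat iotaD map_cat flatten_cat add0n [X in _ ++ X](_ : _ = [::]) ?cats0.
  congr flatten; apply/eq_in_map => i; rewrite mem_iota => /andP[_ lti].
  by rewrite nth_cat lti.
apply/eqP; rewrite -size_eq0 size_flatten sumnE !big_map big_seq big1 // => i.
by rewrite mem_iota size_nseq nth_cat => /andP[lei _]; rewrite ltnNge lei /= nth_nseq if_same.
Qed.

Lemma perm_mshape n (a : 'X_{1..n}) :
  perm_eq a (mshape a ++ nseq (n - size (mshape a)) 0%N).
Proof.
rewrite perm_sym -(permPr (permEl (perm_filterC (fun i => 0 < i)%N a))).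
rewrite (_ : nseq _ _ = [seq i <- (a : seq nat) | ~~ (0 < i)%N]) ?perm_cat2r ?perm_sort //.
have := count_predC (fun i => 0 < i)%N a; rewrite size_tuple => {1}<-.
rewrite size_sort size_filter addKn -size_filter; apply/esym/all_pred1P/allP => i.
by rewrite mem_filter /= -eqn0Ngt => /andP[].
Qed.

(** The word of [a] depends on the order of its exponents, but the coefficients of a symmetric
    polynomial do not: [a] is replaced by its sorted rearrangement [b], whose trailing zeros add no
    letters. *)
Lemma g_path_coeff_mshape k n (a : 'X_{1..n}) :
  (sf_at n (g_path k))@_a = if mdeg a == k then c_part (mshape a) else 0.
Proof.
have szb : size (mshape a ++ nseq (n - size (mshape a)) 0%N) == n.
  by rewrite -(perm_size (perm_mshape n a)) size_tuple.
pose b : 'X_{1..n} := Multinom (Tuple szb).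
have /tuple_permP[s sE] : perm_eq b (a : n.-tuple nat) by rewrite perm_sym perm_mshape.
have bE : b = [multinom a (s i) | i < n].
  by apply: val_inj; apply: val_inj.
have -> : c_part (mshape a) = c_part b.
  by rewrite /c_part /= part_word_pad.
have -> : mdeg a = mdeg b.
  by rewrite -[LHS]sumn_mshape -[RHS]sumn_mshape bE mshape_sym.
by rewrite -g_path_coeff bE; apply/esym/msym_coeff/sf_at_sym.
Qed.

Lemma mcoeff_sym_m n la (a : 'X_{1..n}) :
  (sf_at n (sym_m Zq la))@_a = (perm_eq (mshape a) la)%:R.
Proof.
rewrite (mcoeff_sumX Zq _ (fun a : 'X_{1..n} => perm_eq [seq i <- a : seq nat | (0 < i)%N] la)).
rewrite perm_sort; case: (boolP (perm_eq _ la)) => //= pla; rewrite -sumn_mshape.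
by rewrite (@perm_sumn _ la) ?ltnSn // perm_sort.
Qed.

Lemma mshape_sorted n (a : 'X_{1..n}) : sorted geq (mshape a).
Proof. by apply: sort_sorted => x y; exact: leq_total. Qed.

Lemma mshape_partition k n (a : 'X_{1..n}) : (mshape a \in partitions k) = (mdeg a == k).
Proof.
rewrite mem_partitions /is_partition mshape_sorted sumn_mshape all_sort.
by rewrite filter_all.
Qed.

Lemma perm_mshape_partition k n (a : 'X_{1..n}) la : la \in partitions k ->
  perm_eq (mshape a) la = (la == mshape a).
Proof.
rewrite mem_partitions => /and3P[la_sorted _ _].
apply/idP/eqP => [|-> //]; rewrite perm_sym => pla; apply: (@sorted_eq _ geq) pla => //.
- by move=> y x z /= leyx lezy; exact: leq_trans lezy leyx.
- by move=> x y; rewrite /= andbC -eqn_leq => /eqP->.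
- exact: mshape_sorted.
Qed.

Theorem proposition3p15 (k N : nat) (lt_kN : (k < N)%N) :
  g_sym k (path_hess N) =
  \sum_(la <- partitions k) c_part la *: sym_m {poly int} la.
Proof.
rewrite g_sym_path // -/(g_path k); apply/symfunP => n; apply/mpolyP => a.
rewrite g_path_coeff_mshape -mshape_partition.
transitivity (\sum_(la <- partitions k) c_part la * (la == mshape a)%:R); last first.
  rewrite !raddf_sum /= big_seq [RHS]big_seq; apply: eq_bigr => la la_part.
  by rewrite -(perm_mshape_partition k) // -mcoeff_sym_m; exact/esym/mcoeffZ.
case: ifP => [a_part|/negbT a_part].
  rewrite (bigD1_seq (mshape a)) ?partitions_uniq //= eqxx mulr1 big1 ?addr0 //.
  by move=> la /negbTE->; rewrite mulr0.
rewrite big_seq big1 // => la la_part; case: eqP => [la_a|_]; last by rewrite mulr0.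
by rewrite -la_a la_part in a_part.
Qed.
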